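(* Let $\mathcal{Y}$ be a locally compact Polish space, $\theta>0$, $\beta>0$, $P_0$ a Borel probability measure on $\mathcal{Y}$ without atoms, and $\alpha=\theta P_0$. Let $P_t(z,\mathrm{d}z')$ be the transition function of the Dawson--Watanabe process defined in the context and $\psi_t$, $t>0$, the associated prediction operator $\psi_t(\nu)(\mathrm{d}z')=\int\nu(\mathrm{d}z)P_t(z,\mathrm{d}z')$. Let $s>0$, let $y_1^*,\ldots,y_K^*$ be distinct points of $\mathcal{Y}$ and $\mathbf{m}=(m_1,\ldots,m_K)\in\mathbb{Z}_+^K$. Then $$\psi_t\Big(\Gamma^{\beta+s}_{\alpha+\sum_{i=1}^{K}m_i\delta_{y_i^*}}\Big)=\sum_{\mathbf{n}\in L(\mathbf{m})}\tilde p_{\mathbf{m},\mathbf{n}}(t)\,\Gamma^{\beta+S_t}_{\alpha+\sum_{i=1}^{K}n_i\delta_{y_i^*}},$$ where $L(\mathbf{m})=\{\mathbf{n}\in\mathbb{Z}_+^K:\ n_j\le m_j\text{ for all }j\}$, $$\tilde p_{\mathbf{m},\mathbf{n}}(t)=\mathrm{Bin}(|\mathbf{n}|;\,|\mathbf{m}|,p(t))\;p(\mathbf{n};\mathbf{m},|\mathbf{n}|),$$ $$p(t)=\frac{S_t}{S_0},\qquad S_t=\frac{\beta S_0}{(\beta+S_0)e^{\beta t/2}-S_0},\qquad S_0=s,$$ $\mathrm{Bin}(k;N,q)=\binom{N}{k}q^k(1-q)^{N-k}$ is the Binomial probability mass function with parameters $(N,q)$ at $k$, and $p(\mathbf{n};\mathbf{m},|\mathbf{n}|)=\binom{|\mathbf{m}|}{|\mathbf{n}|}^{-1}\prod_{j=1}^K\binom{m_j}{n_j}$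 is the multivariate hypergeometric probability.
   Context: Notation: $\mathbb{Z}_+=\{0,1,2,\ldots\}$; $|\mathbf{m}|=\sum_jm_j$; for a finite measure $z$ on $\mathcal{Y}$, $|z|=z(\mathcal{Y})$. $\mathrm{Po}(m\mid\lambda)$ is the Poisson probability mass function with mean $\lambda$ at $m$; $\mathrm{Ga}(a,b)$ is the gamma distribution with shape $a$ and rate $b$. Gamma random measure: for a finite nonzero Borel measure $\gamma$ on $\mathcal{Y}$ and $b>0$, $\Gamma_\gamma^b$ is the law, on the space $\mathcal{M}(\mathcal{Y})$ of finite Borel measures on $\mathcal{Y}$, of the random measure $z$ such that for every measurable partition $A_1,\ldots,A_k$ of $\mathcal{Y}$ the variables $z(A_1),\ldots,z(A_k)$ are independent with $z(A_i)\sim\mathrm{Ga}(\gamma(A_i),b)$ (equal to $0$ a.s. if $\gamma(A_i)=0$). Dawson--Watanabe process: the $\mathcal{M}(\mathcal{Y})$-valued Markov process with transition function, for $t>0$, $$P_t(z,\mathrm{d}z')=\sum_{m=0}^\infty \mathrm{Po}\Big(m\,\Big|\,\frac{|z|\beta}{e^{\beta t/2}-1}\Big)\int_{\mathcal{Y}^m}\Gamma^{\beta+S_t^*}_{\alpha+\sum_{i=1}^m\delta_{y_i}}(\mathrm{d}z')\,(z/|z|)^m(\mathrm{d}y_1,\ldots,\mathrm{d}y_m),\qquad S_t^*=\frac{\beta}{e^{\beta t/2}-1},$$ where $(z/|z|)^m$ is the $m$-fold product measure (if $z=0$ only the $m=0$ term is present, i.e. $P_t(0,\cdot)=\Gamma_\alpha^{\beta+S_t^*}$).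 *)

(* Defs.v *)
From HB Require Import structures.
From mathcomp Require Import all_boot all_order all_algebra.
From mathcomp Require Import all_classical all_reals all_analysis.
From mathcomp Require Import measurable_realfun.

Set Implicit Arguments.
Unset Strict Implicit.
Unset Printing Implicit Defensive.

Import Order.TTheory GRing.Theory Num.Theory.
Import numFieldNormedType.Exports.

Local Open Scope classical_set_scope.
Local Open Scope ring_scope.

Notation borel Y := (g_sigma_algebraType (@open Y)).

Definition separable_space (Y : topologicalType) : Prop :=
  exists2 D : set Y, countable D & dense D.

(* The existing topology of Y is the one induced by some complete metric d. *)
Definition completely_metrizable (R : realType) (Y : topologicalType) : Prop :=
  exists d : Y -> Y -> R,
    [/\ (forall x y, 0 <= d x y) /\ (forall x y, d x y = 0 <-> x = y),
        (forall x y, d x y = d y x) /\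
          (forall x y z, d x z <= d x y + d y z),
        (forall A : set Y, open A <->
           (forall x, A x -> exists2 e : R, 0 < e & [set y | d x y < e] `<=` A))
      & (forall u : nat -> Y,
           (forall e : R, 0 < e -> exists N : nat, forall m n,
              (N <= m)%N -> (N <= n)%N -> d (u m) (u n) < e) ->
           exists l : Y, u @ \oo --> l)].

Definition polish (R : realType) (Y : topologicalType) : Prop :=
  separable_space Y /\ completely_metrizable R Y.

(* On the Borel sigma-algebra of a Polish space, where singletons are
   measurable, an atom is a point of positive mass. *)
Definition no_atoms d (T : measurableType d) (R : realType)
    (mu : set T -> \bar R) : Prop :=
  forall x : T, mu [set x] = 0%E.

Section finite_measures.
Context d (T : measurableType d) (R : realType).

Definition finite_measures : Type := {finite_measure set T -> \bar R}.

HB.instance Definition _ := gen_eqMixin finite_measures.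
HB.instance Definition _ := gen_choiceMixin finite_measures.
HB.instance Definition _ :=
  isPointed.Build finite_measures (mzero : {finite_measure set T -> \bar R}).

(* The sigma-algebra on the space of finite measures is the one generated by
   the evaluations z |-> z A, A measurable; for the Borel sets of a Polish space
   it is the Borel sigma-algebra of the weak topology. *)
Definition finite_measures_measurable : set (set finite_measures) :=
  <<s \bigcup_(A in measurable)
        preimage_set_system [set: finite_measures]
          (fun z : finite_measures => z A) measurable >>.

Let fm_set0 : finite_measures_measurable set0.
Proof. exact: sigma_algebra0. Qed.

Let fm_setC (U : set finite_measures) :
  finite_measures_measurable U -> finite_measures_measurable (~` U).
Proof. exact: sigma_algebraC. Qed.

Let fm_bigcup (F : (set finite_measures)^nat) :
  (forall i, finite_measures_measurable (F i)) ->
  finite_measures_measurable (\bigcup_i F i).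
Proof. exact: sigma_algebra_bigcup. Qed.

Definition finite_measures_display : measure_display.
Proof. by constructor. Qed.

HB.instance Definition _ :=
  @isMeasurable.Build finite_measures_display finite_measures
    finite_measures_measurable fm_set0 fm_setC fm_bigcup.

Definition mass (z : finite_measures) : R := fine (z [set: T]).

End finite_measures.

Section add_atoms.
Context d (T : measurableType d) (R : realType).
Variables (alpha : finite_measures T R) (K : nat)
  (w : 'I_K -> nat) (y : 'I_K -> T).
Local Open Scope ereal_scope.

Definition add_atoms (A : set T) : \bar R :=
  alpha A + \sum_(i < K) (w i)%:R%:E * \d_(y i) A.

Let summand (n : nat) : {measure set T -> \bar R} :=
  if n is m.+1 then
    if insub m is Some i then mscale ((w i)%:R : R)%:nng%R \d_(y i) else mzero
  else alpha.

Let add_atomsE : add_atoms = msum summand K.+1.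
Proof.
apply/funext => A; rewrite /msum big_ord_recl /=; congr (_ + _).
by apply: eq_bigr => i _; rewrite /summand /= valK.
Qed.

Let add_atoms0 : add_atoms set0 = 0.
Proof. by rewrite add_atomsE measure0. Qed.

Let add_atoms_ge0 A : 0 <= add_atoms A.
Proof. by rewrite add_atomsE. Qed.

Let add_atoms_sigma_additive : semi_sigma_additive add_atoms.
Proof. by rewrite add_atomsE; exact: measure_semi_sigma_additive. Qed.

HB.instance Definition _ := isMeasure.Build _ _ _ add_atoms
  add_atoms0 add_atoms_ge0 add_atoms_sigma_additive.

Let add_atoms_fin : fin_num_fun add_atoms.
Proof.
move=> A mA; rewrite /add_atoms fin_numD fin_num_measure//=.
by apply/sum_fin_numP => i _; rewrite fin_numM// fin_num_measure.
Qed.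

HB.instance Definition _ := @Measure_isFinite.Build _ _ _ add_atoms
  add_atoms_fin.

Definition add_atoms_fm : finite_measures T R := add_atoms.

End add_atoms.

Section prob_power.
Context d (T : measurableType d) (R : realType) (P : probability T R).

Section step.
Variables (n : nat) (Q : probability (n.-tuple T) R).
Local Open Scope ereal_scope.

Let cons_pair (p : T * n.-tuple T) := [the n.+1.-tuple T of p.1 :: p.2].

Let mcons : measurable_fun setT cons_pair.
Proof. exact: measurable_cons. Qed.

Definition tuple_product : set (n.+1.-tuple T) -> \bar R :=
  pushforward (P \x Q) cons_pair.

Let tuple_product0 : tuple_product set0 = 0.
Proof. by rewrite /tuple_product /pushforward preimage_set0 measure0. Qed.

Let tuple_product_ge0 A : 0 <= tuple_product A.
Proof. exact: measure_ge0. Qed.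

Let tuple_product_sigma_additive : semi_sigma_additive tuple_product.
Proof. exact: measure_semi_sigma_additive. Qed.

HB.instance Definition _ := isMeasure.Build _ _ _ tuple_product
  tuple_product0 tuple_product_ge0 tuple_product_sigma_additive.

Let tuple_product_setT : tuple_product setT = 1.
Proof. by rewrite /tuple_product /pushforward preimage_setT probability_setT. Qed.

HB.instance Definition _ :=
  Measure_isProbability.Build _ _ _ tuple_product tuple_product_setT.
End step.

Fixpoint product_power (n : nat) : probability (n.-tuple T) R :=
  if n is m.+1 then tuple_product (product_power m) else \d_[tuple].

End prob_power.

Definition mutually_independent d (Omega : measurableType d) (R : realType)
    (P : probability Omega R) (k : nat) (X : 'I_k -> Omega -> R) : Prop :=
  forall B : 'I_k -> set R, (forall i, measurable (B i)) ->
    P (\bigcap_(i in [set: 'I_k]) (X i @^-1` B i)) =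
    (\prod_(i < k) P (X i @^-1` B i))%E.

Section gamma_distribution.
Context (R : realType).

Definition Gamma_fun (a : R) : R :=
  (\int[lebesgue_measure]_(x in `]0, +oo[) (x `^ (a - 1) * expR (- x)))%R.

Definition gamma_pdf (a b x : R) : R :=
  b `^ a / Gamma_fun a * x `^ (a - 1) * expR (- (b * x)).

(* Ga(a, b), b being the rate; Ga(0, b) is the Dirac mass at 0. *)
Definition gamma_dist (a b : R) (B : set R) : \bar R :=
  if a == 0 then \d_(0 : R) B
  else (\int[lebesgue_measure]_(x in B `&` `]0%R, +oo[) (gamma_pdf a b x)%:E)%E.

End gamma_distribution.

Section gamma_random_measure.
Context d (T : measurableType d) (R : realType).
Local Notation M := (finite_measures T R).

Definition is_gamma_random_measure (gamma : M) (b : R) (P : probability M R)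
    : Prop :=
  forall (k : nat) (A : 'I_k -> set T),
    (forall i, measurable (A i)) -> trivIset [set: 'I_k] A ->
    \bigcup_(i in [set: 'I_k]) A i = [set: T] ->
    mutually_independent P (fun i (z : M) => fine (z (A i))) /\
    (forall i (B : set R), measurable B ->
       P [set z | B (fine (z (A i)))] = gamma_dist (fine (gamma (A i))) b B).

(* Gam gamma b is the law denoted \Gamma_gamma^b. It is uniquely determined: the
   above fixes the joint law of the z (A i) for every measurable partition A. *)
Definition gamma_random_measures (Gam : M -> R -> probability M R) : Prop :=
  forall (gamma : M) (b : R), gamma [set: T] != 0%E -> 0 < b ->
    is_gamma_random_measure gamma b (Gam gamma b).

End gamma_random_measure.

(* Unlike the library's poisson_pmf, this is \d_0 for lambda = 0. *)
Definition Po (R : realType) (m : nat) (lambda : R) : R :=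
  lambda ^+ m / m`!%:R * expR (- lambda).

Section dawson_watanabe.
Context (R : realType) (Y : ptopologicalType).
Local Notation M := (finite_measures (borel Y) R).
Variables (Gam : M -> R -> probability M R) (alpha : M) (beta : R).

(* The second argument of mnormalize is a default, used only if z = 0. *)
Definition normalize (z : M) : probability (borel Y) R :=
  mnormalize z \d_(point : borel Y).

Definition Sstar (t : R) : R := beta / (expR (beta * t / 2) - 1).

(* For z = 0, Po m 0 = 0 cancels all the terms with m > 0, and the term m = 0
   does not depend on the value of normalize z. *)
Definition dw_transition (t : R) (z : M) (B : set M) : \bar R :=
  (\sum_(0 <= m <oo)
     (Po m (mass z * beta / (expR (beta * t / 2) - 1))%R)%:E *
     \int[product_power (normalize z) m]_y
       Gam (add_atoms_fm alpha (fun=> 1%N) (tnth y)) (beta + Sstar t)%R B)%E.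

Definition prediction (t : R) (nu : probability M R) (B : set M) : \bar R :=
  (\int[nu]_z dw_transition t z B)%E.

End dawson_watanabe.

Section weights.
Context (R : realType).

Definition Scoef (beta s t : R) : R :=
  beta * s / ((beta + s) * expR (beta * t / 2) - s).

Definition hypergeometric (K : nat) (m n : 'I_K -> nat) : R :=
  ('C(\sum_(j < K) m j, \sum_(j < K) n j)%:R)^-1 *
  \prod_(j < K) 'C(m j, n j)%:R.

Definition ptilde (beta s t : R) (K : nat) (m n : 'I_K -> nat) : R :=
  binomial_pmf (\sum_(j < K) m j)%N (Scoef beta s t / s) (\sum_(j < K) n j)%N *
  hypergeometric m n.

End weights.

(* L(m), as a finite type: n j ranges over 0, ..., m j. *)
Notation lower_set m := {dffun forall j, 'I_(m j).+1}.

(* Main.v *)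
Require Import Defs.
From HB Require Import structures.
From mathcomp Require Import all_boot all_order all_algebra.
From mathcomp Require Import all_classical all_reals all_analysis.
From mathcomp Require Import measurable_realfun.
From mathcomp Require Import ring lra.

Set Implicit Arguments.
Unset Strict Implicit.
Unset Printing Implicit Defensive.

Import Order.TTheory GRing.Theory Num.Theory.
Import numFieldNormedType.Exports.

Local Open Scope classical_set_scope.
Local Open Scope ring_scope.

(* Both sides are tested against the functionals
   [z |-> exp (- \sum_j c j * z (E j))], [E] a finite measurable partition and
   [c j >= 0]; by a Bernstein-type approximation and the pi-lambda theorem these
   determine a law on finite measures, and the same argument transfers the
   measurability of the integrands from these functionals to all events.

   On such a functional everything is explicit. An atom in the cell [E j]
   contributes the factor [b / (b + c j)] to the Laplace functional of the gamma
   random measure with rate [b], so the inner integral is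
   multiplicative in the points drawn from [z / |z|]. Poissonizing their number
   makes the transition kernel map an exponential functional to a constant times
   an exponential functional, with [c j] replaced by
   [S c j / (b + c j)], where [S = Sstar beta t] and [b = beta + S]. Integrating
   against the gamma law with rate [beta + s] gives the factor
   [1 - p + p v j], [v j = B / (B + c j)], [B = beta + Scoef beta s t], for each
   atom in [E j]: it is the probability generating function at [v j] of a
   Bernoulli variable, hence the independent binomial thinning of the
   multiplicities. *)

(** * Dominated convergence for unit-valued integrands *)

Section integration.
Local Open Scope ereal_scope.
Context d (T : measurableType d) (R : realType).

Lemma dominated_cvg01 (P : probability T R) (f_ : (T -> \bar R)^nat)
    (f : T -> \bar R) :
  (forall n, measurable_fun setT (f_ n)) -> (forall n x, 0 <= f_ n x <= 1) ->
  (forall x, f_ ^~ x @ \oo --> f x) ->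
  \int[P]_x f_ n x @[n --> \oo] --> \int[P]_x f x.
Proof.
move=> mf f01 ff; apply: (@dominated_cvg _ _ _ P setT _ _ _ (cst 1)) => //.
- by apply/finite_measure_integrable_cst.
- by move=> n x _; have /andP[f0 f1] := f01 n x; rewrite gee0_abs.
Qed.

Lemma integral01 (P : probability T R) (f : T -> \bar R) :
  measurable_fun setT f -> (forall x, 0 <= f x <= 1) ->
  0 <= \int[P]_x f x <= 1.
Proof.
move=> mf f01; apply/andP; split.
  by apply: integral_ge0 => x _; case/andP: (f01 x).
rewrite -[leRHS](@probability_setT _ _ _ P) -[leRHS]mul1e.
rewrite -(integral_cst P measurableT).
by apply: ge0_le_integral => //= x _; case/andP: (f01 x).
Qed.

(** The series are integrals against the counting measure, dominated by the summable [p]. *)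
Lemma nneseries_dominated_cvg01 (p : nat -> R) (u_ : nat -> nat -> \bar R)
    (u : nat -> \bar R) :
  (forall n, (0 <= p n)%R) -> \sum_(0 <= n <oo) (p n)%:E < +oo ->
  (forall k n, 0 <= u_ k n <= 1) -> (forall n, u_ ^~ n @ \oo --> u n) ->
  \sum_(0 <= n <oo) (p n)%:E * u_ k n @[k --> \oo] -->
  \sum_(0 <= n <oo) (p n)%:E * u n.
Proof.
move=> p0 sp u01 uu.
have u0 n : 0 <= u n.
  by apply: (cvge_ge _ (uu n)); near=> k; case/andP: (u01 k n).
have uE k : \sum_(0 <= n <oo) (p n)%:E * u_ k n =
    \int[counting]_n ((p n)%:E * u_ k n).
  rewrite ge0_integral_count// => n.
  by rewrite mule_ge0 ?lee_fin//; case/andP: (u01 k n).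
under eq_fun do rewrite uE.
rewrite -ge0_integral_count; last by move=> n; rewrite mule_ge0 ?lee_fin.
apply: (@dominated_cvg _ _ _ counting setT _ _ _ (fun n => (p n)%:E)) => //.
- by move=> n _; apply: cvgeZl.
- apply/integrableP; split => //.
  rewrite ge0_integral_count//=.
  by under eq_eseriesr do rewrite ger0_norm//.
- move=> k n _; have /andP[v0 v1] := u01 k n.
  by rewrite gee0_abs ?mule_ge0 ?lee_fin// -[leRHS]mule1 lee_wpmul2l ?lee_fin.
Unshelve. all: end_near. Qed.

End integration.

(** * Change of variables with a weight *)

Section change_of_variables.
Local Open Scope ereal_scope.
Context d1 d2 (S : measurableType d1) (T : measurableType d2) (R : realType).
Variables (mu : {measure set S -> \bar R}) (nu : {measure set T -> \bar R}).
Variables (X : S -> T) (W : S -> R).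
Hypotheses (mX : measurable_fun setT X) (mW : measurable_fun setT W).
Hypothesis W0 : forall x, (0 <= W x)%R.
Hypothesis XW :
  forall B, measurable B -> \int[mu]_(x in X @^-1` B) (W x)%:E = nu B.

Import HBNNSimple.

Let density_change_nnsfun (f : {nnsfun T >-> R}) :
  \int[mu]_x ((f (X x))%:E * (W x)%:E) = \int[nu]_y (f y)%:E.
Proof.
under [RHS]eq_integral do rewrite fimfunE -fsumEFin//.
rewrite [RHS]ge0_integral_fsum//; last 2 first.
  - by move=> r; exact/measurable_EFinP/measurableT_comp.
  - by move=> n x _; rewrite EFinM nnfun_muleindic_ge0.
under [LHS]eq_integral.
  move=> x _; rewrite fimfunE -fsumEFin// muleC ge0_mule_fsumr; last first.
    by move=> r; rewrite EFinM nnfun_muleindic_ge0.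
  over.
rewrite [LHS]ge0_integral_fsum//; last 2 first.
  - move=> r; apply/measurable_EFinP; apply: measurable_funM => //.
    apply: measurable_funM => //.
    have mI : measurable_fun setT (\1_(f @^-1` [set r]) : T -> R).
      exact: measurable_indic.
    exact: (measurableT_comp mI mX).
  - move=> n x _; apply: mule_ge0; first by rewrite lee_fin.
    by rewrite EFinM nnfun_muleindic_ge0.
apply: eq_fsbigr => r _; rewrite integralZl_indic_nnsfun//=.
(* A negative [r] is not a value of [f], so both sides vanish; for the others [r] can be pulled out
   of a nonnegative integral. *)
have [r0|r0] := leP 0%R r; last first.
  have f0 : f @^-1` [set r] = set0.
    by apply/seteqP; split => // y /= fy; move: r0; rewrite -fy ltNge fun_ge0.
  rewrite f0 integral_indic// set0I measure0 mule0.
  by apply: integral0_eq => x _; rewrite indic0 /= mulr0 mule0.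
rewrite integral_indic// setIT -XW// [in RHS]integral_mkcond -ge0_integralZl//=.
- apply: eq_integral => x _; rewrite patchE indicE.
  have -> : (X x \in f @^-1` [set r]) = (x \in X @^-1` (f @^-1` [set r])).
    by apply/idP/idP; rewrite !inE.
  case: ifPn => _; first by rewrite mulr1 muleC.
  by rewrite mulr0 !mule0.
- apply/(measurable_restrictT _ _).1; last first.
    exact/measurable_EFinP/measurable_funTS.
  by rewrite -[X in measurable X]setTI; exact: mX.
- by move=> x _; rewrite patchE; case: ifPn; rewrite ?lee_fin.
Qed.

(** Monotone convergence extends the identity from simple functions. It covers a change of law
    ([W = 1]), a density ([X = id]), and a weight depending on the other coordinates in the proof of
    independence. *)
Lemma ge0_integral_density_change (phi : T -> \bar R) :
  measurable_fun setT phi -> (forall y, 0 <= phi y) ->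
  \int[mu]_x (phi (X x) * (W x)%:E) = \int[nu]_y phi y.
Proof.
move=> mphi phi0.
pose f_ := nnsfun_approx measurableT mphi.
have cf y : (f_ n y)%:E @[n --> \oo] --> phi y by exact: cvg_nnsfun_approx.
have f0 n y : 0 <= (f_ n y)%:E by rewrite lee_fin.
have nf y : {homo (fun n => (f_ n y)%:E) : m n / (m <= n)%N >-> m <= n}.
  by move=> m n mn; rewrite lee_fin; exact/lefP/nd_nnsfun_approx.
have mf n : measurable_fun setT (fun y => (f_ n y)%:E) by exact/measurable_EFinP.
transitivity (limn (fun n => \int[mu]_x ((f_ n (X x))%:E * (W x)%:E))).
  rewrite -monotone_convergence//=.
  - apply: eq_integral => x _; apply/esym/cvg_lim => //.
    by apply: cvgeZr => //; exact: cf.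
  - move=> n; apply: emeasurable_funM => //; last exact/measurable_EFinP.
    exact: (measurableT_comp (mf n)).
  - by move=> n x _; rewrite mule_ge0 ?lee_fin.
  - move=> x _ m n mn; apply: lee_wpmul2r; first by rewrite lee_fin.
    exact: nf.
transitivity (limn (fun n => \int[nu]_y (f_ n y)%:E)); last first.
  rewrite -monotone_convergence//=.
  by apply: eq_integral => y _; apply/cvg_lim.
by apply: congr_lim; apply/funext => n; exact: density_change_nnsfun.
Qed.

End change_of_variables.

(** * Product formula for independent variables *)

Section independence.
Local Open Scope ereal_scope.
Context d (Omega : measurableType d) (R : realType) (P : probability Omega R).

(** Independence is the case of indicators; these are replaced by general functions one coordinate
    at a time. *)
Lemma integral_prod_independent k (X : 'I_k -> Omega -> R)
    (phi : 'I_k -> R -> R) :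
  mutually_independent P X -> (forall i, measurable_fun setT (X i)) ->
  (forall i, measurable_fun setT (phi i)) ->
  (forall i x, (0 <= phi i x <= 1)%R) ->
  \int[P]_w (\prod_(i < k) phi i (X i w))%:E =
  \prod_(i < k) \int[P]_w (phi i (X i w))%:E.
Proof.
move=> indX mX mphi phi01.
(* Only the coordinates from [l] on are required to be indicators: [l = 0] is the definition of
   independence, [l = k] the claim. *)
suff H : forall l (phi : 'I_k -> R -> R) (B : 'I_k -> set R),
    (forall i, measurable_fun setT (phi i)) ->
    (forall i x, (0 <= phi i x <= 1)%R) -> (forall i, measurable (B i)) ->
    (forall i : 'I_k, (l <= i)%N -> phi i = \1_(B i)) ->
    \int[P]_w (\prod_(i < k) phi i (X i w))%:E =
    \prod_(i < k) \int[P]_w (phi i (X i w))%:E.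
  by apply: (H k _ (fun=> setT)) => // i; rewrite leqNgt ltn_ord.
elim => [|l IH] {mphi phi01}phi B mphi phi01 mB phiB.
  have mXB i : measurable (X i @^-1` B i).
    by rewrite -[X in measurable X]setTI; exact: mX.
  transitivity (\int[P]_w (\1_(\bigcap_(i in [set: 'I_k]) (X i @^-1` B i)) w)%:E).
    apply: eq_integral => w _; congr EFin; rewrite indicE.
    under eq_bigr => i _ do rewrite phiB// indicE.
    case: (pselect ((\bigcap_(i in [set: 'I_k]) (X i @^-1` B i)) w)) => Bw.
      rewrite mem_set// big1// => i _; rewrite mem_set//; exact: Bw.
    rewrite memNset//; apply/eqP/prodf_eq0.
    move/existsNP : Bw => [i /not_implyP[_ Bi]]; exists i => //.
    by rewrite memNset.
  rewrite integral_indic//; last first.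
    by apply: fin_bigcap_measurable => // i _; exact: mXB.
  rewrite setIT; apply: (eq_trans (indX B mB)); apply: eq_bigr => i _; rewrite phiB//.
  rewrite (_ : (fun w => _) = (fun w => (\1_(X i @^-1` B i) w)%:E)).
    by rewrite integral_indic// setIT.
  by apply/funext => w; rewrite !indicE; congr (_%:R%:E); apply/idP/idP; rewrite !inE.
have [lk|kl] := ltnP l k; last first.
  by apply: (IH _ B) => // i li; have := leq_ltn_trans (leq_trans kl li) (ltn_ord i); rewrite ltnn.
pose i0 := Ordinal lk.
pose W w := (\prod_(i < k | i != i0) phi i (X i w))%R.
have mphiX i : measurable_fun setT (fun w => phi i (X i w)).
  by apply: measurableT_comp => //; exact: mphi.
have phiX01 i : 0 <= \int[P]_w (phi i (X i w))%:E <= 1.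
  by apply: integral01 => [|w]; [exact/measurable_EFinP|rewrite !lee_fin].
have mW : measurable_fun setT W.
  rewrite /W; under eq_fun do rewrite big_mkcond.
  by apply: measurable_prod => i _; case: (i != i0).
have W0 w : (0 <= W w)%R by apply: prodr_ge0 => i _; case/andP: (phi01 i (X i w)).
pose c := \prod_(i < k | i != i0) \int[P]_w (phi i (X i w))%:E.
have c0 : 0 <= c by apply: prode_ge0 => i _; case/andP: (phiX01 i).
have cfin : c \is a fin_num.
  apply: prode_fin_num => i _; have /andP[? ?] := phiX01 i.
  by rewrite ge0_fin_numE// (le_lt_trans _ (ltry 1)).
have fc0 : (0 <= fine c)%R by exact: fine_ge0.
(* Weighting by the other factors turns the law of [X i0] into [c] times itself, so [phi i0] can be
   integrated against it by change of variables. *)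
have WC C : measurable C ->
    \int[P]_(w in X i0 @^-1` C) (W w)%:E =
    mscale (NngNum fc0) (pushforward P (X i0)) C.
  move=> mC; rewrite /mscale/= fineK// muleC.
  (* With [\1_C] in place of [phi i0], the indicators start at [l] and the induction hypothesis
     applies. *)
  pose phi' i := if i == i0 then \1_C else phi i.
  pose B' i := if i == i0 then C else B i.
  have IHC : \int[P]_w (\prod_(i < k) phi' i (X i w))%:E =
      \prod_(i < k) \int[P]_w (phi' i (X i w))%:E.
    apply: (IH _ B').
    - by move=> i; rewrite /phi'; case: ifPn => // _; exact: measurable_indic.
    - move=> i x; rewrite /phi'; case: ifPn => // _.
      by rewrite indicE; case: (_ \in _); rewrite /= ?lexx ?ler01.
    - by move=> i; rewrite /B'; case: ifPn.
    - move=> i li; rewrite /phi' /B'; case: ifPn => [//|ii0]; apply: phiB.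
      rewrite ltn_neqAle li andbT; apply: contra ii0 => /eqP li0.
      by apply/eqP/val_inj.
  have indC w : (\1_C (X i0 w) : R) = \1_(X i0 @^-1` C) w.
    by rewrite !indicE; congr (_%:R); apply/idP/idP; rewrite !inE.
  transitivity (\int[P]_w (\prod_(i < k) phi' i (X i w))%:E).
    rewrite integral_mkcond; apply: eq_integral => w _.
    rewrite (bigD1 i0)//= {1}/phi' eqxx indC patchE indicE.
    under eq_bigr => i ii0 do rewrite /phi' (negbTE ii0).
    by rewrite -/(W w); case: ifPn => _; rewrite ?mul1r ?mul0r.
  rewrite IHC (bigD1 i0)//=; congr (_ * _).
    rewrite /phi' eqxx; under eq_integral do rewrite indC.
    rewrite integral_indic ?setIT//.
    by rewrite -[X in measurable X]setTI; exact: mX.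
  by apply: eq_bigr => i ii0; rewrite /phi' (negbTE ii0).
have := ge0_integral_density_change (mX i0) mW W0 (WC (mX i0)) (phi := EFin \o phi i0).
rewrite ge0_integral_mscale//=; last 2 first.
  - exact/measurable_EFinP.
  - by move=> x _; rewrite lee_fin; case/andP: (phi01 i0 x).
rewrite ge0_integral_pushforward//=; last 2 first.
  - exact/measurable_EFinP.
  - by move=> x _; rewrite lee_fin; case/andP: (phi01 i0 x).
rewrite fineK// => H.
rewrite [RHS](bigD1 i0)//= -/c muleC.
rewrite preimage_setT in H.
rewrite -H; last 2 first.
  - exact/measurable_EFinP.
  - by move=> x; rewrite lee_fin; case/andP: (phi01 i0 x).
by apply: eq_integral => w _; rewrite (bigD1 i0).
Qed.

End independence.

(** * Laplace transform of the gamma distribution *)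

Section gamma_laplace.
Context (R : realType).

Lemma Gamma_fun_ge0 (a : R) : 0 <= Gamma_fun a.
Proof. by apply: Rintegral_ge0 => x _; rewrite mulr_ge0 ?powR_ge0 ?expR_ge0. Qed.

Lemma gamma_pdf_ge0 (a b x : R) : 0 <= gamma_pdf a b x.
Proof.
by rewrite /gamma_pdf !mulr_ge0 ?invr_ge0 ?powR_ge0 ?expR_ge0 ?Gamma_fun_ge0.
Qed.

Lemma measurable_gamma_pdf (a b : R) : measurable_fun setT (gamma_pdf a b).
Proof.
rewrite /gamma_pdf; apply: measurable_funM.
  by apply: measurable_funM => //; exact: measurable_powR.
apply: measurableT_comp; first exact: measurable_expR.
by apply: measurableT_comp => //; exact: measurable_funM.
Qed.

(** Exponential tilting keeps the shape and moves the rate to [b + c]; the constant corrects the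
    power of the rate, and [Gamma_fun a] is common to both sides. *)
Lemma gamma_pdf_tilt (a b c x : R) : 0 < b -> 0 <= c ->
  expR (- (c * x)) * gamma_pdf a b x = (b / (b + c)) `^ a * gamma_pdf a (b + c) x.
Proof.
move=> b0 c0; have bc0 : 0 < b + c by rewrite ltr_wpDr.
rewrite /gamma_pdf mulrDl opprD expRD.
have -> : b `^ a = (b / (b + c)) `^ a * (b + c) `^ a.
  by rewrite -powRM ?divrK ?unitfE ?gt_eqF ?divr_ge0 ?ltW.
ring.
Qed.

Section law.
Local Open Scope ereal_scope.
Context d (Omega : measurableType d) (P : probability Omega R).

(* The normalization hypothesis, which holds as soon as [gamma_dist a (b + c)]
   is the law of some variable, spares the evaluation of the gamma integral. *)
Lemma gamma_laplace (a b c : R) (X : Omega -> R) :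
  measurable_fun setT X -> (0 < b)%R -> (0 <= c)%R ->
  (forall B, measurable B -> P (X @^-1` B) = gamma_dist a b B) ->
  gamma_dist a (b + c) setT = 1 ->
  \int[P]_w (expR (- (c * X w)))%:E = ((b / (b + c)) `^ a)%:E.
Proof.
move=> mX b0 c0; rewrite /gamma_dist.
have mphi : measurable_fun setT (fun x : R => (expR (- (c * x)))%:E).
  apply/measurable_EFinP; apply: measurableT_comp; first exact: measurable_expR.
  by apply: measurableT_comp => //; exact: measurable_funM.
have phi0 x : 0 <= (expR (- (c * x)))%:E by rewrite lee_fin expR_ge0.
(* For [a = 0] the law is the Dirac mass at 0 and both sides are 1. *)
case: eqVneq => [-> XP _|a0 XP norm].
  have := @ge0_integral_density_change _ _ _ _ R P \d_(0%R : R) X (cst 1%R) mX.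
  move=> /(_ (measurable_cst _) (fun=> ler01)).
  move=> /(_ _ _ mphi phi0); rewrite integral_dirac// diracT mul1e/=.
  rewrite mulr0 oppr0 expR0 powRr0 => <-.
    by apply: eq_integral => w _; rewrite mule1.
  move=> B mB; rewrite -XP// integral_cst ?mul1e//.
  by rewrite -[X in measurable X]setTI; exact: mX.
(* The indicator carries the restriction to the positive half-line, which [gamma_dist] has in its
   domain of integration. *)
pose W x : R := (gamma_pdf a b x * \1_(`]0%R, +oo[ : set R) x)%R.
have mW : measurable_fun setT W.
  apply: measurable_funM; first exact: measurable_gamma_pdf.
  exact: measurable_indic.
have W0 x : (0 <= W x)%R by rewrite mulr_ge0 ?gamma_pdf_ge0.
have pdfW (f : R -> R) (B : set R) :
    \int[lebesgue_measure]_(x in B) (f x * \1_(`]0%R, +oo[ : set R) x)%:E =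
    \int[lebesgue_measure]_(x in B `&` `]0%R, +oo[) (f x)%:E.
  rewrite integral_mkcondr; apply: eq_integral => x _; rewrite patchE indicE.
  by case: ifPn => _; rewrite ?mulr1 ?mulr0.
have WX (m : measurable_fun setT X) (B : set R) : measurable B ->
    \int[lebesgue_measure]_(x in (id : R -> R) @^-1` B) (W x)%:E = pushforward P X B.
  by move=> mB; rewrite /W pdfW// -XP.
transitivity (\int[pushforward P X]_x (expR (- (c * x)))%:E).
  by rewrite ge0_integral_pushforward// => x _; exact: phi0.
rewrite -(@ge0_integral_density_change _ _ (measurableTypeR R) R R _ _ id W
  (@measurable_id _ _ setT) mW W0 (WX mX) _ mphi phi0).
under eq_integral => x _.
  rewrite -EFinM /W mulrA gamma_pdf_tilt// -mulrA EFinM; over.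
rewrite ge0_integralZl//=; last 3 first.
- apply/measurable_EFinP/measurable_funM; first exact: measurable_gamma_pdf.
  exact: measurable_indic.
- by move=> x _; rewrite lee_fin mulr_ge0 ?gamma_pdf_ge0.
- by rewrite lee_fin powR_ge0.
by rewrite pdfW// norm mule1.
Unshelve. all: exact: mX. Qed.

End law.
End gamma_laplace.

(** * Laplace functional of a gamma random measure *)

Section laplace_functional.
Context d (T : measurableType d) (R : realType).
Local Notation M := (finite_measures T R).

Lemma measurable_evaluation (A : set T) : measurable A ->
  measurable_fun setT (fun z : M => z A).
Proof.
move=> mA _ B mB; rewrite setTI; apply: sub_sigma_algebra.
by exists A => //; exists B => //; rewrite setTI.
Qed.

Lemma measurable_fine_evaluation (A : set T) : measurable A ->
  measurable_fun setT (fun z : M => fine (z A)).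
Proof.
move=> mA; apply: measurableT_comp; first exact: fine_measurable.
exact: measurable_evaluation.
Qed.

Lemma fine_evaluation_ge0 (z : M) (A : set T) : 0 <= fine (z A).
Proof. exact/fine_ge0. Qed.

Definition measurable_partition k (E : 'I_k -> set T) : Prop :=
  [/\ forall i, measurable (E i), trivIset [set: 'I_k] E &
      \bigcup_(i in [set: 'I_k]) E i = [set: T]].

Definition exponential k (E : 'I_k -> set T) (c : 'I_k -> R) (z : M) : R :=
  expR (- \sum_(j < k) c j * fine (z (E j))).

Lemma exponential_prod k (E : 'I_k -> set T) (c : 'I_k -> R) (z : M) :
  exponential E c z = \prod_(j < k) expR (- (c j * fine (z (E j)))).
Proof. by rewrite /exponential -sumrN expR_sum. Qed.

Lemma exponential01 k (E : 'I_k -> set T) (c : 'I_k -> R) (z : M) :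
  (forall j, 0 <= c j) -> 0 <= exponential E c z <= 1.
Proof.
move=> c0; rewrite expR_ge0/= expR_le1 oppr_le0.
by apply: sumr_ge0 => j _; rewrite mulr_ge0 ?fine_evaluation_ge0.
Qed.

Lemma measurable_exponential k (E : 'I_k -> set T) (c : 'I_k -> R) :
  (forall j, measurable (E j)) -> measurable_fun setT (exponential E c).
Proof.
move=> mE; apply: measurableT_comp; first exact: measurable_expR.
apply: measurableT_comp => //; apply: measurable_sum => j.
by apply: measurable_funM => //; exact: measurable_fine_evaluation.
Qed.

(** The masses of the cells are independent gamma variables, so the integral factorizes into
    one-dimensional Laplace transforms. *)
Lemma gamma_random_measure_laplace (Gam : M -> R -> probability M R)
    (gamma : M) (b : R) k (E : 'I_k -> set T) (c : 'I_k -> R) :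
  gamma_random_measures Gam -> gamma [set: T] != 0%E -> 0 < b ->
  measurable_partition E -> (forall j, 0 <= c j) ->
  (\int[Gam gamma b]_z (exponential E c z)%:E =
   (\prod_(j < k) (b / (b + c j)) `^ fine (gamma (E j)))%:E)%E.
Proof.
move=> hGam g0 b0 [mE tE cE] c0.
have [indE lawE] := hGam gamma b g0 b0 _ E mE tE cE.
have mX j := measurable_fine_evaluation (mE j).
(* The absolute value bounds [phi j] by 1 on the whole line and changes nothing on masses. *)
pose phi (j : 'I_k) (x : R) := expR (- (c j * `|x|)).
transitivity (\int[Gam gamma b]_z (\prod_(j < k) phi j (fine (z (E j))))%:E)%E.
  apply: eq_integral => z _; rewrite exponential_prod; congr EFin.
  by apply: eq_bigr => j _; rewrite /phi ger0_norm ?fine_evaluation_ge0.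
rewrite (integral_prod_independent (phi := phi) indE mX); last 2 first.
- move=> j; apply: measurableT_comp; first exact: measurable_expR.
  apply: measurableT_comp => //; apply: measurable_funM => //.
- by move=> j x; rewrite expR_ge0/= expR_le1 oppr_le0 mulr_ge0.
rewrite -prodEFin; apply: eq_bigr => j _.
rewrite -(gamma_laplace (mX j) b0 (c0 j) (lawE j)); last first.
  (* [gamma_dist] with rate [b + c j] has total mass 1 because it is the law of the mass of [E j]
     under [Gam gamma (b + c j)]. *)
  have bc0 : 0 < b + c j by rewrite ltr_wpDr.
  have [_ lawE'] := hGam gamma _ g0 bc0 _ E mE tE cE.
  by rewrite -lawE'// (_ : [set z | _] = setT) ?probability_setT//; apply/seteqP.
by apply: eq_integral => z _; rewrite /phi ger0_norm ?fine_evaluation_ge0.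
Qed.

End laplace_functional.

(** * Approximation of half-line indicators by polynomials in an exponential *)

Section bernstein.
Variable R : realType.

Lemma bernoulli_inequality (u : R) (k : nat) : -1 <= u ->
  1 + k%:R * u <= (1 + u) ^+ k.
Proof.
move=> u1; elim: k => [|k IH]; first by rewrite mul0r addr0 expr0.
have u10 : 0 <= 1 + u by lra.
rewrite exprS; apply: le_trans (ler_wpM2l u10 IH).
rewrite -natr1; have : 0 <= k%:R * u ^+ 2 by rewrite mulr_ge0 ?sqr_ge0.
lra.
Qed.

(** With [y = n r], the bound [expR y >= (1 + y / 2) ^+ 2] dominates [n (n + 1)] up to the stated
    constant. *)
Lemma nexpN_le (r : R) (n : nat) : 0 < r ->
  n%:R * expR (- (n%:R * r)) <= (4 / r ^+ 2 + r^-1) * harmonic n.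
Proof.
move=> r0; rewrite expRN /harmonic ler_pdivlMr ?ltr0n// mulrAC ler_pdivrMr ?expR_gt0//.
have := expR_ge1Dx (n%:R * r / 2); set y := n%:R * r => hy.
have y0 : 0 <= y by rewrite mulr_ge0// ltW.
have -> : y = y / 2 + y / 2 by lra.
rewrite expRD.
have : (1 + y / 2) * (1 + y / 2) <= expR (y / 2) * expR (y / 2).
  by apply: ler_pM => //; lra.
have nE : n%:R = y / r by rewrite mulfK// gt_eqF.
have c0 : 0 <= 4 / r ^+ 2 + r^-1 by rewrite addr_ge0 ?divr_ge0 ?invr_ge0 ?sqr_ge0 ?ltW.
move/(ler_wpM2l c0); apply: le_trans.
rewrite -natr1 nE.
have -> : y / r * (y / r + 1) = (y ^+ 2) / r ^+ 2 + y / r by field; rewrite gt_eqF.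
have -> : (4 / r ^+ 2 + r^-1) * ((1 + y / 2) * (1 + y / 2)) =
  y ^+ 2 / r ^+ 2 + y / r + (4 / r ^+ 2 * (1 + y) + r^-1 * (1 + y ^+ 2 / 4)).
  by field; rewrite gt_eqF.
have y20 := sqr_ge0 y; rewrite lerDl; apply: addr_ge0; apply: mulr_ge0; try lra.
  by rewrite divr_ge0// sqr_ge0.
by rewrite invr_ge0 ltW.
Qed.

(* Polynomials in [expR (- x)] approximating the indicator of [x > a]: the
   exponent balances [n 2^n expR (- n x ln 2 / a)], which tends to [+oo] for
   [x <= a] and to [0] for [x > a]. *)
Definition threshold_base (a : R) (n : nat) (x : R) : R :=
  expR (- (n%:R * (ln 2 / a) * x)).

Definition threshold_approx (a : R) (n : nat) (x : R) : R :=
  (1 - threshold_base a n x) ^+ (n * 2 ^ n)%N.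

Lemma threshold_base01 (a : R) n x : 0 < a -> 0 <= x ->
  0 <= threshold_base a n x <= 1.
Proof.
move=> a0 x0; rewrite expR_ge0/= expR_le1 oppr_le0 mulr_ge0// mulr_ge0//.
by rewrite divr_ge0 ?(ltW a0)// ln_ge0// ler1n.
Qed.

Lemma threshold_approx01 (a : R) n x : 0 < a -> 0 <= x ->
  0 <= threshold_approx a n x <= 1.
Proof.
move=> a0 x0; have /andP[b0 b1] := threshold_base01 n a0 x0.
by rewrite exprn_ge0 ?exprn_ile1//; lra.
Qed.

(** Writing [2 ^ n] as an exponential recentres the exponent at [x = a]: the sign of [x / a - 1]
    decides between decay and growth. *)
Lemma threshold_baseE (a : R) n x : 0 < a ->
  (2 ^ n)%:R * threshold_base a n x = expR (- (n%:R * (ln 2 * (x / a - 1)))).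
Proof.
move=> a0; rewrite natrX -[X in X ^+ n](@lnK _ 2) ?posrE ?ltr0n//.
rewrite -expRM_natl -expRD; congr expR; rewrite -mulr_natl.
by field; rewrite gt_eqF.
Qed.

Lemma cvg_threshold_approx (a x : R) : 0 < a -> 0 <= x ->
  threshold_approx a n x @[n --> \oo] --> ((a < x)%R%:R : R).
Proof.
move=> a0 x0; have ln2 : 0 < ln 2 :> R by rewrite ln_gt0// ltr1n.
have [ax|xa] := ltP a x.
(* Above the threshold, Bernoulli's inequality bounds the defect from 1 by [n 2^n] times the base,
   which [nexpN_le] makes [O(1/n)]. *)
- pose r := ln 2 * (x / a - 1).
  have r0 : 0 < r by rewrite mulr_gt0// subr_gt0 ltr_pdivlMr// mul1r.
  apply: (@squeeze_cvgr _ _ _ _ (fun n => 1 - (4 / r ^+ 2 + r^-1) * harmonic n) (cst 1)).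
  + apply: nearW => n; have /andP[b0 b1] := threshold_base01 n a0 x0.
    have /andP[_ ->] := threshold_approx01 n a0 x0; rewrite andbT.
    apply: le_trans (@bernoulli_inequality (- threshold_base a n x) _ _); last by lra.
    rewrite mulrN lerD2l lerN2 natrM -mulrA threshold_baseE//.
    exact: nexpN_le.
  + rewrite -[X in _ --> X](subr0 1); apply: cvgB; first exact: cvg_cst.
    rewrite -[X in _ --> X](mulr0 (4 / r ^+ 2 + r^-1)); apply: cvgM; first exact: cvg_cst.
    exact: cvg_harmonic.
  + exact: cvg_cst.
(* Below it, [(1 - u) ^+ K * (1 + u) ^+ K <= 1], while Bernoulli's inequality gives
   [(1 + u) ^+ K >= 1 + K u >= n + 1]. *)
- apply: (@squeeze_cvgr _ _ _ _ (cst 0) harmonic).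
  + apply: nearW => n; have /andP[b0 b1] := threshold_base01 n a0 x0.
    have /andP[-> _] := threshold_approx01 n a0 x0; rewrite andTb.
    have u0 : 0 <= 1 + threshold_base a n x by lra.
    have nb : n%:R <= (n * 2 ^ n)%:R * threshold_base a n x.
      rewrite natrM -mulrA threshold_baseE// ler_peMr//.
      rewrite -[leLHS]expR0 ler_expR oppr_ge0.
      apply: mulr_ge0_le0 => //; apply: mulr_ge0_le0; first exact: ltW.
      by rewrite subr_le0 ler_pdivrMr// mul1r.
    have u1 : -1 <= threshold_base a n x by lra.
    have := bernoulli_inequality (n * 2 ^ n)%N u1.
    rewrite /threshold_approx /harmonic; set K := (n * 2 ^ n)%N; set u := threshold_base a n x => h.
    rewrite -[leRHS]mul1r ler_pdivlMr ?ltr0n//.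
    apply: (@le_trans _ _ ((1 - u) ^+ K * (1 + u) ^+ K)).
      apply: ler_wpM2l; first by rewrite exprn_ge0//; rewrite -/u in b1; lra.
      by apply: le_trans h; rewrite -natr1 addrC lerD2l.
    by rewrite -exprMn exprn_ile1//; rewrite -/u in b0 b1 *; nra.
  + exact: cvg_cst.
  + exact: cvg_harmonic.
Qed.

End bernstein.

Lemma indic_bool (R : pzRingType) (T : Type) (A : set T) (x : T) (b : bool) :
  (A x <-> b) -> \1_A x = b%:R :> R.
Proof.
case: b => Ab; rewrite indicE; first by rewrite mem_set//; exact/Ab.
by rewrite memNset// => /Ab.
Qed.

(** * From exponential functionals to all events *)

Section exponential_class.
Context d (T : measurableType d) (R : realType).
Local Notation M := (finite_measures T R).

Lemma measurable_partition_sum (z : M) k (E : 'I_k -> set T) (P : pred 'I_k)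
    (A : set T) : measurable_partition E -> A = \bigcup_(j in [set j | P j]) E j ->
  fine (z A) = \sum_(j < k | P j) fine (z (E j)).
Proof.
move=> [mE tE cE] ->; rewrite sum_fine; last by move=> j _; rewrite fin_num_measure.
rewrite -measure_bigsetU_ord//; congr (fine (z _)).
rewrite -bigcup_seq_cond; apply: eq_bigcupl; split => j /=.
  by rewrite mem_index_enum.
by case/andP.
Qed.

Definition nonneg_simple (s : seq (set T * R)) : Prop :=
  forall p, p \in s -> measurable p.1 /\ 0 <= p.2.

(** The sets may overlap, unlike the cells of a partition, so that a product of such functionals is
    given by concatenating the lists. *)
Definition exponential_seq (s : seq (set T * R)) (z : M) : R :=
  expR (- \sum_(p <- s) p.2 * fine (z p.1)).

Lemma exponential_seq_cat (s t : seq (set T * R)) z :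
  exponential_seq (s ++ t) z = exponential_seq s z * exponential_seq t z.
Proof. by rewrite /exponential_seq big_cat/= opprD expRD. Qed.

Lemma nonneg_simple_cat s t :
  nonneg_simple s -> nonneg_simple t -> nonneg_simple (s ++ t).
Proof. by move=> ns nt p; rewrite mem_cat => /orP[/ns|/nt]. Qed.

(** The cells are indexed by membership patterns in the sets of [s]; the coefficient of a cell adds
    those of the sets containing it. Empty cells are harmless. *)
Lemma exponential_seq_partition (s : seq (set T * R)) : nonneg_simple s ->
  exists k (E : 'I_k -> set T) (c : 'I_k -> R),
    [/\ measurable_partition E, forall j, 0 <= c j &
        exponential_seq s = exponential E c].
Proof.
move=> ns; pose n := size s.
pose A (i : 'I_n) := (tnth (in_tuple s) i).1.
pose a (i : 'I_n) := (tnth (in_tuple s) i).2.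
have mA i : measurable (A i) by have [] := ns _ (mem_tnth i (in_tuple s)).
have a0 i : 0 <= a i by have [] := ns _ (mem_tnth i (in_tuple s)).
pose k := #|{ffun 'I_n -> bool}|.
pose f (j : 'I_k) : {ffun 'I_n -> bool} := enum_val j.
pose E (j : 'I_k) :=
  \bigcap_(i in [set: 'I_n]) (if f j i then A i else ~` A i).
have cellP x j : E j x <-> f j = [ffun i => x \in A i].
  split=> [Ex|fj i _].
    apply/ffunP => i; rewrite ffunE; have := Ex i I.
    by case: (f j i) => ?; [rewrite mem_set|rewrite memNset].
  by rewrite fj ffunE; case: ifPn; [rewrite inE|rewrite notin_setE].
have pE : measurable_partition E.
  split.
  - move=> j; apply: fin_bigcap_measurable => // i _.
    by case: (f j i) => //; exact: measurableC.
  - move=> j1 j2 _ _ [x [/cellP e1 /cellP e2]].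
    by apply: enum_val_inj; rewrite -/(f j1) -/(f j2) e1 e2.
  - apply/seteqP; split => // x _.
    exists (enum_rank [ffun i => x \in A i]) => //.
    by apply/cellP; rewrite /f enum_rankK.
exists k, E, (fun j => \sum_(i < n | f j i) a i); split => //.
  by move=> j; apply: sumr_ge0.
apply/funext => z; rewrite /exponential_seq /exponential; congr (expR (- _)).
rewrite big_tnth -/n.
transitivity (\sum_(i < n) \sum_(j < k | f j i) a i * fine (z (E j))).
  apply: eq_bigr => i _; rewrite -mulr_sumr; congr (_ * _).
  apply: measurable_partition_sum => //; apply/seteqP; split => [x Ax|x [j /= fji]].
    exists (enum_rank [ffun i => x \in A i]) => /=.
      by rewrite /f enum_rankK ffunE mem_set.
    by apply/cellP; rewrite /f enum_rankK.
  by move=> /cellP ej; move: fji; rewrite ej ffunE inE.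
rewrite (exchange_big_dep predT)//=; apply: eq_bigr => j _.
by rewrite mulr_suml.
Qed.

Lemma exponential_seq01 s z : nonneg_simple s -> 0 <= exponential_seq s z <= 1.
Proof.
by move=> /exponential_seq_partition[k [E [c [_ c0 ->]]]]; exact: exponential01.
Qed.

Lemma measurable_exponential_seq s : nonneg_simple s ->
  measurable_fun setT (exponential_seq s).
Proof.
move=> /exponential_seq_partition[k [E [c [[mE _ _] _ ->]]]].
exact: measurable_exponential.
Qed.

Definition unit_valued (h : M -> R) : Prop :=
  measurable_fun setT h /\ forall z, 0 <= h z <= 1.

(* Laplace functionals determine a random measure; the conclusion is phrased
   for a general property H so as to apply also to measurability claims. *)
Variable H : (M -> R) -> Prop.
Hypothesis H_exponential : forall k (E : 'I_k -> set T) (c : 'I_k -> R),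
  measurable_partition E -> (forall j, 0 <= c j) -> H (exponential E c).
Hypothesis H_sub : forall h1 h2 h3 : M -> R,
  unit_valued h1 -> unit_valued h2 -> unit_valued h3 ->
  (forall z, h1 z = h2 z + h3 z) -> H h1 -> H h2 -> H h3.
Hypothesis H_lim : forall (h_ : nat -> M -> R) (h : M -> R),
  (forall n, unit_valued (h_ n)) -> unit_valued h ->
  (forall z, h_ n z @[n --> \oo] --> h z) -> (forall n, H (h_ n)) -> H h.

(** [H] is stable under differences and limits but perhaps not under products; demanding it against
    every exponential factor yields a property that survives the multiplications below. *)
Let Hexp (h : M -> R) := unit_valued h /\
  forall s, nonneg_simple s -> H (fun z => exponential_seq s z * h z).

Let unit_valued_exp s h : nonneg_simple s -> unit_valued h ->
  unit_valued (fun z => exponential_seq s z * h z).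
Proof.
move=> ns [mh h01]; split.
  by apply: measurable_funM => //; exact: measurable_exponential_seq.
move=> z; have /andP[? ?] := h01 z; have /andP[? ?] := exponential_seq01 z ns.
by rewrite mulr_ge0// mulr_ile1.
Qed.

Let Hexp1 : Hexp (cst 1).
Proof.
split; first by split => // z; rewrite ler01 lexx.
move=> s ns; have [k [E [c [pE c0 sE]]]] := exponential_seq_partition ns.
rewrite (_ : (fun z => _) = exponential E c); first exact: H_exponential.
by apply/funext => z; rewrite sE mulr1.
Qed.

(** After multiplication by the functional of [s], this is a difference of the functionals of [s]
    and [s ++ t], each times [h]. *)
Let HexpB t h : nonneg_simple t -> Hexp h ->
  Hexp (fun z => (1 - exponential_seq t z) * h z).
Proof.
move=> nt [uh hh].
have u : unit_valued (fun z => (1 - exponential_seq t z) * h z).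
  split.
    apply: measurable_funM; last exact: uh.1.
    by apply: measurable_funB => //; exact: measurable_exponential_seq.
  move=> z; have /andP[? ?] := uh.2 z; have /andP[? ?] := exponential_seq01 z nt.
  by rewrite mulr_ge0 ?mulr_ile1//; lra.
split=> // s ns.
apply: (H_sub (h1 := fun z => exponential_seq s z * h z)
  (h2 := fun z => exponential_seq (s ++ t) z * h z)).
- exact: unit_valued_exp.
- by apply: unit_valued_exp => //; exact: nonneg_simple_cat.
- exact: unit_valued_exp.
- by move=> z; rewrite exponential_seq_cat; ring.
- exact: hh.
- by apply: hh; exact: nonneg_simple_cat.
Qed.

(** [threshold_approx] is a power of one minus an exponential functional: iterate [HexpB], then pass
    to the limit. *)
Let Hexp_threshold (A : set T) (a : R) h : measurable A -> 0 < a -> Hexp h ->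
  Hexp (fun z => \1_[set z : M | a < fine (z A)] z * h z).
Proof.
move=> mA a0 hh.
have mset : measurable [set z : M | a < fine (z A)].
  rewrite (_ : [set z | _] = (fun z : M => fine (z A)) @^-1` `]a, +oo[).
    by rewrite -[X in measurable X]setTI; exact: measurable_fine_evaluation.
  by apply/seteqP; split => z /=; rewrite in_itv/= andbT.
pose g n (z : M) := threshold_approx a n (fine (z A)) * h z.
have gP n : Hexp (g n).
  pose t := [:: (A, n%:R * (ln 2 / a))].
  have nt : nonneg_simple t.
    move=> p; rewrite inE => /eqP ->; split => //=.
    by rewrite mulr_ge0// divr_ge0 ?(ltW a0)// ln_ge0// ler1n.
  have tE (z : M) : threshold_base a n (fine (z A)) = exponential_seq t z.
    by rewrite /threshold_base /exponential_seq big_seq1.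
  rewrite /g /threshold_approx; elim: (n * 2 ^ n)%N => [|m IH].
    by rewrite (_ : (fun z => _) = h)//; apply/funext => z; rewrite expr0 mul1r.
  rewrite (_ : (fun z => _) = (fun z => (1 - exponential_seq t z) *
      ((1 - threshold_base a n (fine (z A))) ^+ m * h z))).
    exact: HexpB.
  by apply/funext => z; rewrite exprS -mulrA tE.
have gcvg z : g n z @[n --> \oo] --> \1_[set z : M | a < fine (z A)] z * h z.
  apply: cvgM; last exact: cvg_cst.
  rewrite (@indic_bool _ _ _ _ (a < fine (z A)))//.
  by apply: cvg_threshold_approx => //; exact: fine_evaluation_ge0.
have u : unit_valued (fun z => \1_[set z : M | a < fine (z A)] z * h z).
  split; first by apply: measurable_funM; [exact: measurable_indic|exact: hh.1.1].
  move=> z; have /andP[? ?] := hh.1.2 z.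
  by rewrite indicE; case: (_ \in _); rewrite ?mul1r ?mul0r ?lexx ?ler01//; apply/andP.
split=> // s ns.
apply: (H_lim (h_ := fun n z => exponential_seq s z * g n z)).
- by move=> n; apply: unit_valued_exp => //; exact: (gP n).1.
- exact: unit_valued_exp.
- by move=> z; apply: cvgM; [exact: cvg_cst|exact: gcvg].
- by move=> n; exact: (gP n).2.
Qed.

Let threshold_set (l : seq (set T * R)) :=
  [set z : M | forall p, p \in l -> p.2 < fine (z p.1)].

(** The generating pi-system: lists make it closed under intersection. The levels are positive, as
    the approximation at a threshold demands. *)
Let thresholds := [set U | exists2 l : seq (set T * R),
  (forall p, p \in l -> measurable p.1 /\ 0 < p.2) & U = threshold_set l].

Let thresholdsI : setI_closed thresholds.
Proof.
move=> _ _ [l1 hl1 ->] [l2 hl2 ->]; exists (l1 ++ l2).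
  by move=> p; rewrite mem_cat => /orP[/hl1|/hl2].
apply/seteqP; split => [z [z1 z2] p|z zl].
  by rewrite mem_cat => /orP[/z1|/z2].
by split => p pl; apply: zl; rewrite mem_cat pl ?orbT.
Qed.

Let Hexp_threshold_set l : (forall p, p \in l -> measurable p.1 /\ 0 < p.2) ->
  Hexp (\1_(threshold_set l)).
Proof.
elim: l => [_|[A a] l IH hl].
  rewrite (_ : \1_ _ = cst 1)//; apply/funext => z.
  by rewrite indicE mem_set.
have [mA a0] := hl (A, a) (mem_head _ _).
have {}IH := IH (fun p pl => hl p (mem_behead (s := (A, a) :: l) pl)).
have := Hexp_threshold mA a0 IH.
rewrite (_ : (fun z => _) = \1_(threshold_set ((A, a) :: l)))//.
apply/funext => z; rewrite -[LHS]/((\1_ _ \* \1_ _) z) -indicI.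
congr (\1_ _ _); apply/seteqP; split => [w [/= wA wl] p|w wl].
  by rewrite inE => /orP[/eqP ->//|/wl].
split; first exact: (wl _ (mem_head _ _)).
by move=> p pl; apply: wl; rewrite inE pl orbT.
Qed.

Let L (B : set M) := measurable B /\ H (\1_B).

Let unit_valued_indic (B : set M) : measurable B -> unit_valued (\1_B).
Proof.
move=> mB; split; first exact: measurable_indic.
by move=> z; rewrite indicE; case: (_ \in _); rewrite ?lexx ?ler01.
Qed.

(** [H_sub] handles proper differences and [H_lim] increasing unions. *)
Let lambda_L : lambda_system setT L.
Proof.
have LT : L setT.
  split => //; have := Hexp1.2 [::]; rewrite (_ : (fun z => _) = \1_setT).
    by apply => p; rewrite in_nil.
  apply/funext => z.
  by rewrite /exponential_seq big_nil oppr0 expR0 mul1r indicT.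
split => //.
- move=> A B BA [mA HA] [mB HB]; split; first exact: measurableD.
  apply: (H_sub (h1 := \1_A) (h2 := \1_B)) => //; try exact: unit_valued_indic.
    by apply: unit_valued_indic; exact: measurableD.
  move=> z; rewrite !indicE in_setD.
  have [zB|zB] := boolP (z \in B); last by rewrite add0r andbT.
  by rewrite andbF addr0 mem_set//; apply: BA; rewrite inE in zB.
- move=> F ndF LF.
  have mF : measurable (\bigcup_i F i).
    by apply: bigcup_measurable => i _; exact: (LF i).1.
  split => //; apply: (H_lim (h_ := fun n => \1_(F n))) => //.
  + by move=> n; apply: unit_valued_indic; exact: (LF n).1.
  + exact: unit_valued_indic.
  + move=> z; have [[i _ Fiz]|nF] := pselect ((\bigcup_i F i) z).
      apply: cvg_near_cst; exists i => // n /= ni.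
      rewrite !indicE !mem_set//; first by exists i.
      by move/ndF : ni => /subsetPset; exact.
    apply: cvg_near_cst; apply: nearW => n.
    rewrite !indicE !memNset// => Fnz; apply: nF; by exists n.
  + by move=> n; exact: (LF n).2.
Qed.

Let measurable_thresholds : @measurable _ M `<=` <<s thresholds >>.
Proof.
apply: smallest_sub; first exact: smallest_sigma_algebra.
move=> _ [A mA [C mC <-]]; rewrite setTI.
suff mev : measurable_fun setT
    (fun z : g_sigma_algebraType thresholds => (z : M) A).
  by have := mev measurableT C mC; rewrite setTI.
apply: (measurability _ (ErealGenOInfty.measurableE R)).
move=> _ [_ [r ->] <-]; rewrite setTI.
have rE (a : R) : (fun z : M => z A) @^-1` `]a%:E, +oo[ = [set z : M | a < fine (z A)].
  apply/seteqP; split => z /=; rewrite in_itv/= andbT.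
    by rewrite -{1}(@fineK _ (z A)) ?fin_num_measure// lte_fin.
  by rewrite -{2}(@fineK _ (z A)) ?fin_num_measure// lte_fin.
have pos (a : R) : 0 < a -> <<s thresholds >> [set z : M | a < fine (z A)].
  move=> a0; apply: sub_sigma_algebra; exists [:: (A, a)].
    by move=> p; rewrite inE => /eqP ->.
  apply/seteqP; split => [z /= az p|z /= /(_ (A, a))].
    by rewrite inE => /eqP ->.
  by apply; rewrite inE.
(* Level 0 is the union of the levels [1 / (n + 1)]; a negative level gives the whole space. *)
rewrite rE; have [r0|r0|->] := ltgtP r 0; last 1 first.
- rewrite (_ : [set z | _] =
      \bigcup_n [set z : M | (n.+1%:R)^-1 < fine (z A)]).
    by apply: sigma_algebra_bigcup => n; apply: pos; rewrite invr_gt0 ltr0n.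
  apply/seteqP; split => [z /= z0|z [n _] /=]; last first.
    by apply: lt_trans; rewrite invr_gt0 ltr0n.
  by have [n] := ltr_add_invr z0; rewrite add0r => nz; exists n.
- rewrite (_ : [set z | _] = setT); last first.
    apply/seteqP; split => z //= _.
    by apply: lt_le_trans r0 _; exact: fine_evaluation_ge0.
  exact: measurableT.
- exact: pos.
Qed.

Lemma exponential_class_measurable (B : set M) : measurable B -> H (\1_B).
Proof.
move=> mB; suff [] : L B by [].
apply: (lambda_system_subset thresholdsI lambda_L) => //; last first.
  exact: measurable_thresholds.
move=> _ [l hl ->]; have [[mU _] HU] := Hexp_threshold_set hl; split.
  rewrite (_ : threshold_set l = \1_(threshold_set l) @^-1` [set 1 : R]).
    by rewrite -[X in measurable X]setTI; exact: mU.
  apply/seteqP; split => z /=; first by move=> ?; rewrite indicE mem_set.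
  rewrite indicE; have [|_ /eqP] := boolP (z \in _); first by rewrite inE.
  by rewrite eq_sym oner_eq0.
(* The empty list contributes the factor 1, which turns [Hexp] back into [H]. *)
have := HU [::]; rewrite (_ : (fun z => _) = \1_(threshold_set l)).
  by apply => p; rewrite in_nil.
by apply/funext => z; rewrite /exponential_seq big_nil oppr0 expR0 mul1r.
Qed.

End exponential_class.

(** * Multiplicative functions of independent samples *)

Section product_power.
Local Open Scope ereal_scope.
Context d (T : measurableType d) (R : realType) (P : probability T R).

Lemma measurable_prod_tnth (u : T -> R) n : measurable_fun setT u ->
  measurable_fun setT (fun y : n.-tuple T => \prod_(i < n) u (tnth y i))%R.
Proof.
move=> mu; apply: measurable_prod => i _.
by apply: measurableT_comp => //; exact: measurable_tnth.
Qed.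

(** Each power is the image under cons of a product measure, so Tonelli splits off one factor at a
    time. *)
Lemma integral_product_power (u : T -> R) (r : R) n :
  measurable_fun setT u -> (forall x, (0 <= u x)%R) ->
  \int[P]_x (u x)%:E = r%:E ->
  \int[product_power P n]_y (\prod_(i < n) u (tnth y i))%:E = (r ^+ n)%:E.
Proof.
move=> mu u0 ur; elim: n => [|n IH] /=.
  rewrite integral_dirac// ?diracT ?mul1e ?big_ord0 ?expr0//.
  by apply/measurable_EFinP; exact: measurable_prod_tnth.
have mcons : measurable_fun setT
    (fun p : T * n.-tuple T => [the n.+1.-tuple T of p.1 :: p.2]).
  exact: measurable_cons.
have f0 m (y : m.-tuple T) : 0 <= (\prod_(i < m) u (tnth y i))%:E.
  by rewrite lee_fin; apply: prodr_ge0.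
have mf m : measurable_fun setT
    (fun y : m.-tuple T => (\prod_(i < m) u (tnth y i))%:E).
  by apply/measurable_EFinP; exact: measurable_prod_tnth.
transitivity (\int[pushforward (P \x product_power P n)
    (fun p : T * n.-tuple T => [the n.+1.-tuple T of p.1 :: p.2])]_y
    (\prod_(i < n.+1) u (tnth y i))%:E).
  exact: eq_measure_integral.
rewrite ge0_integral_pushforward//; last exact: mf.
rewrite preimage_setT.
have consE (p : T * n.-tuple T) :
    ((fun y => (\prod_(i < n.+1) u (tnth y i))%:E) \o
     (fun p : T * n.-tuple T => [the n.+1.-tuple T of p.1 :: p.2])) p =
    (u p.1)%:E * (\prod_(i < n) u (tnth p.2 i))%:E.
  rewrite /= big_ord_recl tnth0 EFinM; congr (_ * _%:E).
  by apply: eq_bigr => i _; rewrite tnthS.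
under eq_integral do rewrite consE.
rewrite fubini_tonelli1/=; last 2 first.
- apply: emeasurable_funM.
    by apply/measurable_EFinP; exact: measurableT_comp.
  exact: (measurableT_comp (mf n)).
- by move=> p; rewrite mule_ge0 ?f0// lee_fin.
rewrite /fubini_F/=.
transitivity (\int[P]_x ((u x)%:E * (r ^+ n)%:E)).
  apply: eq_integral => x _.
  rewrite -IH; apply: (ge0_integralZl (product_power P n) measurableT (mf n)).
    by move=> y _; exact: f0.
  by rewrite lee_fin.
rewrite ge0_integralZr//= ?lee_fin ?exprn_ge0//.
- by rewrite ur exprS.
- exact/measurable_EFinP.
- by move=> x _; rewrite lee_fin.
- by rewrite -lee_fin -ur; apply: integral_ge0 => x _; rewrite lee_fin.
Qed.

End product_power.

(** * Poisson series *)

Section series.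
Variable R : realType.

Lemma expR_eseries (x : R) :
  (\sum_(0 <= n <oo) (x ^+ n / n`!%:R)%:E = (expR x)%:E)%E.
Proof.
apply/cvg_lim => //.
under eq_fun do rewrite sumEFin.
apply: cvg_EFin; first exact: nearW.
exact: (is_cvg_series_exp_coeff x).
Qed.

Lemma Po_ge0 n (l : R) : 0 <= l -> 0 <= Po n l.
Proof. by move=> l0; rewrite /Po !mulr_ge0 ?exprn_ge0 ?invr_ge0 ?expR_ge0. Qed.

(** The probability generating function of the Poisson law at [r]: the powers of [l] and [r] merge
    into an exponential series. *)
Lemma Po_eseries (l r : R) : 0 <= l -> 0 <= r ->
  (\sum_(0 <= n <oo) (Po n l)%:E * (r ^+ n)%:E = (expR (l * (r - 1)))%:E)%E.
Proof.
move=> l0 r0.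
transitivity (\sum_(0 <= n <oo) (expR (- l))%:E * ((l * r) ^+ n / n`!%:R)%:E)%E.
  apply: eq_eseriesr => n _; rewrite -!EFinM; congr EFin.
  by rewrite /Po exprMn; ring.
rewrite nneseriesZl; last first.
  by move=> n _; rewrite lee_fin divr_ge0// exprn_ge0// mulr_ge0.
by rewrite expR_eseries -EFinM -expRD; congr (expR _)%:E; ring.
Qed.

Lemma Po_eseries1 (l : R) : 0 <= l ->
  (\sum_(0 <= n <oo) (Po n l)%:E = 1)%E.
Proof.
move=> l0; have := Po_eseries l0 (@ler01 R).
rewrite subrr mulr0 expR0 => <-.
by apply: eq_eseriesr => n _; rewrite expr1n mule1.
Qed.

End series.

(** * The weights as independent binomial thinnings *)

Section weights.

(** Distributivity of products over sums whose range depends on the factor, reached by passing to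
    [fprod] and tagged indices. *)
Lemma sum_dffun_prod (R : comPzSemiRingType) (I : finType) (m : I -> nat)
    (F : I -> nat -> R) :
  \sum_(f : {dffun forall j, 'I_(m j)}) \prod_j F j (f j) =
  \prod_j \sum_(i < m j) F j i.
Proof.
pose P (j : I) : {ffun 'I_(m j) -> R} := [ffun i : 'I_(m j) => F j i].
rewrite (reindex (@dffun_of_fprod I (fun j => 'I_(m j)))); last first.
  exact/onW_bij/dffun_of_fprod_bij.
transitivity (\sum_(t : fprod (fun j => 'I_(m j))) \prod_(j in I) P j (t j)).
  by apply: eq_bigr => t _; apply: eq_bigr => j _; rewrite /P !ffunE.
rewrite big_fprod; transitivity (\prod_j \sum_(x in
    tagged_with (fun j => 'I_(m j)) j) untag 0 (P j) x).
  by rewrite (bigA_distr_big_dep (fun j x => x \in tagged_with _ j)).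
apply: eq_bigr => j _.
apply: (eq_trans (esym (big_tag (fun j => P j) j))).
by apply: eq_bigr => i _; rewrite /P ffunE.
Qed.

Lemma leq_lower_set (K : nat) (m : 'I_K -> nat) (n : lower_set m) :
  (\sum_(j < K) n j <= \sum_(j < K) m j)%N.
Proof. by apply: leq_sum => j _; rewrite -ltnS ltn_ord. Qed.

Variable R : realType.

(** The coefficient of the binomial law of the total cancels the hypergeometric denominator, nonzero
    since the total of [n] is at most that of [m]. *)
Lemma ptildeE (beta s t : R) (K : nat) (m : 'I_K -> nat) (n : lower_set m) :
  let p := Scoef beta s t / s in
  ptilde beta s t m (fun j => n j) =
  \prod_(j < K) (p ^+ n j * (1 - p) ^+ (m j - n j) * 'C(m j, n j)%:R).
Proof.
move=> p; rewrite /ptilde /hypergeometric /binomial_pmf -/p.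
have nm := leq_lower_set n.
rewrite -mulr_natr -!mulrA mulVKf; last first.
  by rewrite pnatr_eq0 -lt0n bin_gt0.
rewrite !big_split/= !prodrXr mulrA; congr (_ * _ * _); congr (_ ^+ _).
rewrite sumnB// => j _.
by rewrite -ltnS ltn_ord.
Qed.

(** Once the weights factor over coordinates, each coordinate is the binomial theorem. *)
Lemma sum_ptilde (beta s t : R) (K : nat) (m : 'I_K -> nat) (v : 'I_K -> R) :
  let p := Scoef beta s t / s in
  \sum_(n : lower_set m) ptilde beta s t m (fun j => n j) *
    \prod_(j < K) v j ^+ n j = \prod_(j < K) (1 - p + p * v j) ^+ m j.
Proof.
move=> p.
transitivity (\sum_(n : lower_set m) \prod_(j < K)
    (p ^+ n j * (1 - p) ^+ (m j - n j) * 'C(m j, n j)%:R * v j ^+ n j)).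
  by apply: eq_bigr => n _; rewrite ptildeE [RHS]big_split.
rewrite (sum_dffun_prod (fun j => (m j).+1) (fun j i =>
  p ^+ i * (1 - p) ^+ (m j - i) * 'C(m j, i)%:R * v j ^+ i)).
apply: eq_bigr => j _; rewrite exprDn; apply: eq_bigr => i _.
rewrite -[RHS]mulr_natr [(p * v j) ^+ _]exprMn; set A := (1 - p) ^+ _; set B := p ^+ _.
by set C := v j ^+ _; set D := _%:R; ring.
Qed.

End weights.

(** * Contribution of atoms to the Laplace functional *)

Section cell_value.
Context d (T : measurableType d) (R : realType).
Variables (k : nat) (E : 'I_k -> set T).
Hypothesis pE : measurable_partition E.
Local Notation M := (finite_measures T R).

Definition cell_value (q : 'I_k -> R) (x : T) : R :=
  \sum_(j < k) q j * \1_(E j) x.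

Lemma partition_cell x : exists j0, forall j, E j x <-> j == j0.
Proof.
have [mE tE cE] := pE.
have [j0 _ Ex] : (\bigcup_(i in [set: 'I_k]) E i) x by rewrite cE.
exists j0 => j; split=> [Ejx|/eqP -> //].
by apply/eqP/tE => //; exists x.
Qed.

Lemma cell_valueE q x j0 : (forall j, E j x <-> j == j0) ->
  cell_value q x = q j0.
Proof.
move=> j0P; rewrite /cell_value (bigD1 j0)//= (@indic_bool _ _ _ _ (j0 == j0))//.
rewrite eqxx mulr1 big1 ?addr0// => j jj0.
by rewrite (@indic_bool _ _ _ _ (j == j0))// (negbTE jj0) mulr0.
Qed.

Lemma measurable_cell_value q : measurable_fun setT (cell_value q).
Proof.
have [mE _ _] := pE.
by apply: measurable_sum => j; apply: measurable_funM.
Qed.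

Lemma cell_value_ge0 q x : (forall j, 0 <= q j) -> 0 <= cell_value q x.
Proof. by move=> q0; apply: sumr_ge0 => j _; rewrite mulr_ge0. Qed.

Lemma integral_cell_value (P : {finite_measure set T -> \bar R}) q :
  (forall j, 0 <= q j) ->
  (\int[P]_x (cell_value q x)%:E = (\sum_(j < k) q j * fine (P (E j)))%:E)%E.
Proof.
move=> q0; have [mE _ _] := pE.
under eq_integral do rewrite /cell_value -sumEFin.
rewrite ge0_integral_sum//=; last 2 first.
- by move=> j; apply/measurable_EFinP; apply: measurable_funM.
- by move=> j x _; rewrite lee_fin mulr_ge0.
rewrite -sumEFin; apply: eq_bigr => j _.
under eq_integral do rewrite EFinM.
have mI : measurable_fun setT (fun x => (\1_(E j) x)%:E : \bar R).
  by apply/measurable_EFinP; exact: measurable_indic.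
rewrite (ge0_integralZl P measurableT mI); last 2 first.
- by move=> x _; rewrite lee_fin.
- by rewrite lee_fin.
by rewrite integral_indic// setIT EFinM fineK// fin_num_measure.
Qed.

(** An atom raises the exponent of its own cell only; positivity of [q] allows exponents to be
    added. *)
Lemma prod_powR_add_atoms (alpha : M) K (w : 'I_K -> nat) (y : 'I_K -> T)
    (q : 'I_k -> R) : (forall j, 0 < q j) ->
  \prod_(j < k) q j `^ fine (add_atoms_fm alpha w y (E j)) =
  (\prod_(j < k) q j `^ fine (alpha (E j))) *
    \prod_(i < K) cell_value q (y i) ^+ w i.
Proof.
move=> q0; have [mE _ _] := pE.
have addE j : fine (add_atoms_fm alpha w y (E j)) =
    fine (alpha (E j)) + \sum_(i < K) (w i)%:R * \1_(E j) (y i).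
  rewrite /add_atoms_fm /= /add_atoms fineD ?fin_num_measure//; last first.
    by apply/sum_fin_numP => i _; rewrite fin_numM// fin_num_measure.
  congr (_ + _); rewrite -sum_fine; last first.
    by move=> i _; rewrite fin_numM// fin_num_measure.
  by apply: eq_bigr => i _; rewrite diracE indicE.
have powR_sum (a : R) (f : 'I_K -> R) : 0 < a ->
    a `^ (\sum_(i < K) f i) = \prod_(i < K) a `^ f i.
  move=> a0; apply: (big_morph (powR a)); last by rewrite powRr0.
  by move=> u v; rewrite powRD// (gt_eqF a0) implybT.
transitivity (\prod_(j < k) (q j `^ fine (alpha (E j)) *
    \prod_(i < K) q j `^ ((w i)%:R * \1_(E j) (y i)))).
  apply: eq_bigr => j _; rewrite addE powRD ?powR_sum//.
  by rewrite (gt_eqF (q0 j)) implybT.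
rewrite big_split/=; congr (_ * _).
rewrite exchange_big/=; apply: eq_bigr => i _.
have [j0 j0P] := partition_cell (y i).
rewrite (cell_valueE _ j0P) (bigD1 j0)//=.
rewrite (@indic_bool _ _ _ _ (j0 == j0))// eqxx mulr1 powR_mulrn ?(ltW (q0 _))//.
rewrite big1 ?mulr1// => j jj0.
by rewrite (@indic_bool _ _ _ _ (j == j0))// (negbTE jj0) mulr0 powRr0.
Qed.

(* The Laplace functional of [Gam gamma b] at [f = cell_value c] is
   [exp (- \int ln (1 + f / b) d gamma)], so every atom contributes a factor. *)
Lemma add_atoms_laplace (Gam : M -> R -> probability M R) (alpha : M) (b : R)
    (c : 'I_k -> R) K (w : 'I_K -> nat) (y : 'I_K -> T) :
  gamma_random_measures Gam -> alpha [set: T] != 0%E -> 0 < b ->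
  (forall j, 0 <= c j) ->
  (\int[Gam (add_atoms_fm alpha w y) b]_z (exponential E c z)%:E =
   ((\prod_(j < k) (b / (b + c j)) `^ fine (alpha (E j))) *
    \prod_(i < K) cell_value (fun j => b / (b + c j)) (y i) ^+ w i)%:E)%E.
Proof.
move=> hGam a0 b0 c0.
rewrite gamma_random_measure_laplace//; last first.
  rewrite /add_atoms_fm /= /add_atoms gt_eqF//.
  apply: (@lt_le_trans _ _ (alpha setT)); first by rewrite lt0e a0 measure_ge0.
  by apply: leeDl; apply: sume_ge0 => i _; rewrite mule_ge0.
by rewrite prod_powR_add_atoms// => j; rewrite divr_gt0// ltr_wpDr.
Qed.

End cell_value.

(** * Action of the transition kernel on functions *)

Section transition_functional.
Context (R : realType) (Y : ptopologicalType).
Local Notation M := (finite_measures (borel Y) R).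
Variables (Gam : M -> R -> probability M R) (alpha : M) (beta t : R).
Hypotheses (beta0 : 0 < beta) (t0 : 0 < t).
Local Notation S := (Sstar beta t).
Local Notation b := (beta + Sstar beta t).

Lemma Sstar_gt0 : 0 < S.
Proof.
rewrite /Sstar divr_gt0// subr_gt0 -[ltLHS]expR0 ltr_expR.
by rewrite divr_gt0 ?mulr_gt0.
Qed.

Let S0 := Sstar_gt0.
Let b0 : 0 < b. Proof. by rewrite addr_gt0. Qed.

Definition rate (z : M) : R := mass z * beta / (expR (beta * t / 2) - 1).

Lemma rateE z : rate z = mass z * S.
Proof. by rewrite /rate /Sstar mulrA. Qed.

Lemma rate_ge0 z : 0 <= rate z.
Proof. by rewrite rateE mulr_ge0 ?(ltW S0)//; exact: fine_evaluation_ge0. Qed.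

(** For [z = 0] the default value of [normalize z] is multiplied by zero mass, and [z A] vanishes
    too. *)
Lemma mass_normalize (z : M) (A : set (borel Y)) : measurable A ->
  mass z * fine (normalize z A) = fine (z A).
Proof.
move=> mA; rewrite /mass /normalize /= /mnormalize.
have [z0|z0] := eqVneq (z setT) 0%E => /=.
  rewrite z0 mul0r (_ : z A = 0%E)//; apply/eqP; rewrite -measure_le0 -z0.
  by apply: le_measure; rewrite ?inE.
have zfin : z setT \is a fin_num by rewrite fin_num_measure.
have -> : (z setT == +oo%E) = false by apply/negbTE; rewrite -ltey ltey_eq zfin.
rewrite -(@fineK _ (z A)) ?fin_num_measure//= mulrCA mulfV ?mulr1//.
by rewrite fine_eq0.
Qed.

Definition gamma_functional (h : M -> R) (n : nat) (y : n.-tuple (borel Y)) :=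
  (\int[Gam (add_atoms_fm alpha (fun=> 1%N) (tnth y)) b]_w (h w)%:E)%E.

(** The kernel integrated against a function: it is explicit on exponentials and gives
    [dw_transition] on indicators. *)
Definition dw_functional (h : M -> R) (z : M) : \bar R :=
  (\sum_(0 <= n <oo) (Po n (rate z))%:E *
     \int[product_power (normalize z) n]_y gamma_functional h y)%E.

Lemma dw_functional_indic z (B : set M) : measurable B ->
  dw_functional (\1_B) z = dw_transition Gam alpha beta t z B.
Proof.
move=> mB; rewrite /dw_functional /dw_transition; apply: eq_eseriesr => n _.
congr (_ * _)%E; apply: eq_integral => y _.
by rewrite /gamma_functional integral_indic// setIT.
Qed.

Section exponential.
Variables (k : nat) (E : 'I_k -> set (borel Y)) (c : 'I_k -> R).
Hypotheses (pE : measurable_partition E) (c0 : forall j, 0 <= c j).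
Hypotheses (hGam : gamma_random_measures Gam) (alpha0 : alpha [set: Y] != 0%E).

Let q (j : 'I_k) : R := b / (b + c j).

Let q01 j : 0 <= q j <= 1.
Proof.
have bc0 : 0 < b + c j by rewrite ltr_wpDr.
apply/andP; split; first by rewrite divr_ge0// ltW.
by rewrite ler_pdivrMr// mul1r lerDl.
Qed.

Let q0 j : 0 <= q j. Proof. by case/andP: (q01 j). Qed.

Let C := \prod_(j < k) q j `^ fine (alpha (E j)).

Lemma gamma_functional_exponential n (y : n.-tuple (borel Y)) :
  gamma_functional (exponential E c) y =
  (C%:E * (\prod_(i < n) cell_value E q (tnth y i))%:E)%E.
Proof.
by rewrite /gamma_functional add_atoms_laplace// EFinM.
Qed.

Lemma measurable_gamma_functional_exponential n :
  measurable_fun setT (fun y : n.-tuple (borel Y) =>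
    gamma_functional (exponential E c) y).
Proof.
under eq_fun do rewrite gamma_functional_exponential.
apply: emeasurable_funM => //; apply/measurable_EFinP.
by apply: measurable_prod_tnth; exact: measurable_cell_value.
Qed.

(** The sampled points are independent, so the inner integral is [C * r ^+ n], where [r] is the mean
    of [q] under [normalize z]; the Poisson generating function sums the series. *)
Lemma dw_functional_exponential z :
  dw_functional (exponential E c) z =
  (C%:E * (exponential E (fun j => (S * c j / (b + c j))%R) z)%:E)%E.
Proof.
have [mE _ cE] := pE.
have C0 : 0 <= C by apply: prodr_ge0 => j _; rewrite powR_ge0.
pose r := \sum_(j < k) q j * fine (normalize z (E j)).
have r0 : 0 <= r.
  by apply: sumr_ge0 => j _; rewrite mulr_ge0 ?q0//; exact/fine_ge0.
have mu := measurable_cell_value pE q.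
have u0 x := cell_value_ge0 E x q0.
transitivity (\sum_(0 <= n <oo)
    (C%:E * ((Po n (rate z))%:E * (r ^+ n)%:E)))%E.
  apply: eq_eseriesr => n _; rewrite muleCA; congr (_ * _)%E.
  under eq_integral do rewrite gamma_functional_exponential.
  rewrite ge0_integralZl ?lee_fin//; last 2 first.
  - by apply/measurable_EFinP; exact: measurable_prod_tnth.
  - by move=> y _; rewrite lee_fin; apply: prodr_ge0.
  congr (_ * _)%E; apply: integral_product_power => //.
  exact: integral_cell_value.
rewrite nneseriesZl; last first.
  by move=> n _; rewrite -EFinM lee_fin mulr_ge0 ?exprn_ge0// Po_ge0// rate_ge0.
rewrite Po_eseries ?rate_ge0//; congr (_ * (expR _)%:E)%E.
have massE : mass z = \sum_(j < k) fine (z (E j)).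
  apply: (measurable_partition_sum z (P := predT) pE).
  by rewrite -[LHS]cE; exact: eq_bigcupl.
have massr : mass z * r = \sum_(j < k) q j * fine (z (E j)).
  by rewrite mulr_sumr; apply: eq_bigr => j _; rewrite mulrCA mass_normalize.
(* Cell by cell, the exponent is [- S (1 - q j)] times the mass of [E j], and
   [1 - q j = c j / (b + c j)]. *)
rewrite rateE mulrBr mulr1 mulrAC massr massE -sumrN !mulr_suml -sumrB; apply: eq_bigr => j _.
rewrite /q; field; rewrite gt_eqF// ltr_wpDr//.
Qed.

End exponential.

Section continuity.

Local Open Scope ereal_scope.

(** [gamma_random_measures] does not directly assert measurable dependence on the base measure; this
    property is therefore propagated from exponentials. *)
Definition measurable_functional (h : M -> R) := forall n,
  measurable_fun setT (fun y : n.-tuple (borel Y) => gamma_functional h y).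

Let gamma_functional01 h n (y : n.-tuple (borel Y)) : unit_valued h ->
  0 <= gamma_functional h y <= 1.
Proof.
move=> [mh h01]; apply: integral01; first exact/measurable_EFinP.
by move=> z; rewrite !lee_fin.
Qed.

Let power_functional01 h n z : unit_valued h -> measurable_functional h ->
  0 <= \int[product_power (normalize z) n]_y gamma_functional h y <= 1.
Proof.
by move=> uh mh; apply: integral01 => [|y]; [exact: mh|exact: gamma_functional01].
Qed.

Lemma dw_functional01 h z : unit_valued h -> measurable_functional h ->
  0 <= dw_functional h z <= 1.
Proof.
move=> uh mh; apply/andP; split.
  apply: nneseries_ge0 => n _ _; rewrite mule_ge0 ?lee_fin ?Po_ge0 ?rate_ge0//.
  by case/andP: (power_functional01 n z uh mh).
rewrite -[leRHS](Po_eseries1 (rate_ge0 z)); apply: lee_nneseries => n _.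
  move=> _; rewrite mule_ge0 ?lee_fin ?Po_ge0 ?rate_ge0//.
  by case/andP: (power_functional01 n z uh mh).
rewrite -[leRHS]mule1 lee_wpmul2l ?lee_fin ?Po_ge0 ?rate_ge0//.
by case/andP: (power_functional01 n z uh mh).
Qed.

Let gamma_functionalD h1 h2 h3 n (y : n.-tuple (borel Y)) :
  unit_valued h2 -> unit_valued h3 ->
  (forall z, h1 z = h2 z + h3 z)%R ->
  gamma_functional h1 y = gamma_functional h2 y + gamma_functional h3 y.
Proof.
move=> [mh2 h201] [mh3 h301] h123.
have p2 z : setT z -> 0 <= (h2 z)%:E by rewrite lee_fin; case/andP: (h201 z).
have p3 z : setT z -> 0 <= (h3 z)%:E by rewrite lee_fin; case/andP: (h301 z).
have m2 : measurable_fun setT (EFin \o h2) by exact/measurable_EFinP.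
have m3 : measurable_fun setT (EFin \o h3) by exact/measurable_EFinP.
rewrite /gamma_functional -ge0_integralD//.
by apply: eq_integral => z _; rewrite h123 EFinD.
Qed.

Lemma measurable_functional_sub h1 h2 h3 :
  unit_valued h2 -> unit_valued h3 ->
  (forall z, h1 z = h2 z + h3 z)%R ->
  measurable_functional h1 -> measurable_functional h2 ->
  measurable_functional h3.
Proof.
move=> u2 u3 h123 m1 m2 n.
rewrite (_ : (fun y => _) = (fun y : n.-tuple (borel Y) =>
    gamma_functional h1 y - gamma_functional h2 y)).
  by apply: emeasurable_funB; [exact: m1|exact: m2].
apply/funext => y; rewrite (gamma_functionalD y u2 u3 h123) addeAC subee ?add0e//.
have /andP[g0 g1] := gamma_functional01 y u2.
by rewrite ge0_fin_numE// (le_lt_trans g1) ?ltry.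
Qed.

Lemma dw_functionalD h1 h2 h3 z : unit_valued h2 -> unit_valued h3 ->
  (forall z, h1 z = h2 z + h3 z)%R ->
  measurable_functional h2 -> measurable_functional h3 ->
  dw_functional h1 z = dw_functional h2 z + dw_functional h3 z.
Proof.
move=> u2 u3 h123 m2 m3; rewrite /dw_functional -nneseriesD; last 2 first.
- move=> n _ _; rewrite mule_ge0 ?lee_fin ?Po_ge0 ?rate_ge0//.
  by case/andP: (power_functional01 n z u2 m2).
- move=> n _ _; rewrite mule_ge0 ?lee_fin ?Po_ge0 ?rate_ge0//.
  by case/andP: (power_functional01 n z u3 m3).
apply: eq_eseriesr => n _.
have /andP[? _] := power_functional01 n z u2 m2.
have /andP[? _] := power_functional01 n z u3 m3.
rewrite -ge0_muleDr//; congr (_ * _); rewrite -ge0_integralD//.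
- by apply: eq_integral => y _; exact: gamma_functionalD.
- by move=> y _; case/andP: (gamma_functional01 y u2).
- exact: m2.
- by move=> y _; case/andP: (gamma_functional01 y u3).
- exact: m3.
Qed.

Variables (h_ : nat -> M -> R) (h : M -> R).
Hypotheses (u_ : forall n, unit_valued (h_ n)).
Hypothesis hh : forall z, h_ n z @[n --> \oo] --> h z.

Lemma integral_cvg (P : probability M R) :
  \int[P]_z (h_ n z)%:E @[n --> \oo] --> \int[P]_z (h z)%:E.
Proof.
apply: dominated_cvg01.
- by move=> n; apply/measurable_EFinP; exact: (u_ n).1.
- by move=> n z; rewrite !lee_fin; exact: (u_ n).2.
- by move=> z; apply: cvg_EFin; [exact: nearW|exact: hh].
Qed.

Hypothesis mh_ : forall n, measurable_functional (h_ n).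

Lemma measurable_functional_cvg : measurable_functional h.
Proof.
move=> n; apply: (emeasurable_fun_cvg (fun i y => gamma_functional (h_ i) y)).
  by move=> i; exact: mh_.
by move=> y _; exact: integral_cvg.
Qed.

Lemma dw_functional_cvg z : dw_functional (h_ n) z @[n --> \oo] --> dw_functional h z.
Proof.
apply: nneseries_dominated_cvg01.
- by move=> n; rewrite Po_ge0 ?rate_ge0.
- by rewrite Po_eseries1 ?rate_ge0// ltry.
- by move=> i n; exact: power_functional01.
- move=> n; apply: dominated_cvg01.
  + by move=> i; exact: mh_.
  + by move=> i y; exact: gamma_functional01.
  + by move=> y; exact: integral_cvg.
Qed.

End continuity.
End transition_functional.

(** * Rational identities between the parameters *)

Section parameters.
Variables (R : realType) (beta s t : R).
Hypotheses (beta0 : 0 < beta) (s0 : 0 < s) (t0 : 0 < t).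
Local Notation S := (Sstar beta t).

Let S0 : 0 < S := Sstar_gt0 beta0 t0.

Let D0 : 0 < beta + s + S. Proof. by rewrite !addr_gt0. Qed.

(** Substituting [expR (beta * t / 2) = 1 + beta / S] removes the exponential and leaves identities
    for [field]. *)
Lemma ScoefE : Scoef beta s t = s * S / (beta + s + S).
Proof.
have e0 : expR (beta * t / 2) - 1 != 0.
  by rewrite gt_eqF// subr_gt0 -[ltLHS]expR0 ltr_expR divr_gt0 ?mulr_gt0.
have eE : expR (beta * t / 2) = 1 + beta / S.
  by rewrite /Sstar; field; rewrite e0 gt_eqF.
rewrite /Scoef eE; field.
have -> : (beta + s) * (S + beta) + - s * S = beta * (beta + s + S) by ring.
by rewrite !gt_eqF// mulr_gt0.
Qed.

Lemma Scoef_gt0 : 0 < Scoef beta s t.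
Proof. by rewrite ScoefE divr_gt0// mulr_gt0. Qed.

Lemma Scoef_ratio01 : 0 <= Scoef beta s t / s <= 1.
Proof.
rewrite divr_ge0 ?(ltW Scoef_gt0) ?(ltW s0)//= ler_pdivrMr// mul1r ScoefE.
by rewrite ler_pdivrMr// ler_pM2l// lerDr ltW// addr_gt0.
Qed.

Let tilt (c : R) := S * c / (beta + S + c).

Lemma tilt_ge0 (c : R) : 0 <= c -> 0 <= tilt c.
Proof.
have := S0; have := beta0 => b0 S0' c0.
by apply: divr_ge0; [rewrite mulr_ge0// ltW|lra].
Qed.

(** The base measure contributes both in the kernel and in the initial law. The key relation is
    [beta + Scoef beta s t = (beta + s) (beta + S) / (beta + s + S)]. *)
Lemma laplace_factor_alpha (c : R) : 0 <= c ->
  (beta + S) / (beta + S + c) * ((beta + s) / (beta + s + tilt c)) =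
  (beta + Scoef beta s t) / (beta + Scoef beta s t + c).
Proof.
move=> c0; rewrite /tilt ScoefE; field.
have cD := mulr_ge0 c0 (ltW D0); have bD := mulr_gt0 beta0 D0.
have sS := mulr_gt0 s0 S0.
by rewrite !gt_eqF// ltr_wpDr// addr_gt0.
Qed.

(** An initial atom does not enter the constant of the kernel, so only the factor of the initial law
    remains. *)
Lemma laplace_factor_atom (c : R) : 0 <= c ->
  let p := Scoef beta s t / s in
  (beta + s) / (beta + s + tilt c) =
  1 - p + p * ((beta + Scoef beta s t) / (beta + Scoef beta s t + c)).
Proof.
move=> c0; rewrite /tilt ScoefE /=; field.
have cD := mulr_ge0 c0 (ltW D0); have bD := mulr_gt0 beta0 D0.
have sS := mulr_gt0 s0 S0.
by rewrite !gt_eqF// ltr_wpDr// addr_gt0.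
Qed.

End parameters.

(** * The prediction identity, from exponentials to events *)

Section duality.
Context (R : realType) (Y : ptopologicalType).
Local Notation M := (finite_measures (borel Y) R).
Variables (Gam : M -> R -> probability M R) (alpha : M) (beta s t : R).
Hypotheses (beta0 : 0 < beta) (s0 : 0 < s) (t0 : 0 < t).
Hypotheses (hGam : gamma_random_measures Gam) (alpha0 : alpha [set: Y] != 0%E).
Variables (K : nat) (y : 'I_K -> borel Y) (m : 'I_K -> nat).
Local Open Scope ereal_scope.

Let p := (Scoef beta s t / s)%R.

Let predicted (h : M -> R) : \bar R :=
  \int[Gam (add_atoms_fm alpha m y) (beta + s)%R]_z
    dw_functional Gam alpha beta t h z.

Let mixture (h : M -> R) : \bar R :=
  \sum_(n : lower_set m) (ptilde beta s t m (fun j => n j))%:E *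
    \int[Gam (add_atoms_fm alpha (fun j => n j) y) (beta + Scoef beta s t)%R]_z
      (h z)%:E.

Let ptilde_ge0 (n : lower_set m) : (0 <= ptilde beta s t m (fun j => n j))%R.
Proof.
have /andP[p0 p1] := Scoef_ratio01 beta0 s0 t0.
rewrite ptildeE; apply: prodr_ge0 => j _.
by rewrite !mulr_ge0 ?exprn_ge0// subr_ge0.
Qed.

Let predicted_exponential k (E : 'I_k -> set (borel Y)) (c : 'I_k -> R) :
  measurable_partition E -> (forall j, (0 <= c j)%R) ->
  predicted (exponential E c) = mixture (exponential E c).
Proof.
move=> pE c0.
pose S := Sstar beta t.
have S0 : (0 < S)%R := Sstar_gt0 beta0 t0.
have bs0 : (0 < beta + s)%R by rewrite addr_gt0.
have bS0 : (0 < beta + S)%R by rewrite addr_gt0.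
have bt0 : (0 < beta + Scoef beta s t)%R by rewrite addr_gt0// Scoef_gt0.
pose c' j := (S * c j / (beta + S + c j))%R.
have c'0 j : (0 <= c' j)%R := tilt_ge0 beta0 t0 (c0 j).
have ratio_gt0 (a x : R) : (0 < a)%R -> (0 <= x)%R -> (0 < a / (a + x))%R.
  by move=> a0 x0; rewrite divr_gt0// ltr_wpDr.
pose C := (\prod_(j < k) ((beta + S) / (beta + S + c j)) `^ fine (alpha (E j)))%R.
have C0 : (0 <= C)%R by apply: prodr_ge0 => j _; rewrite powR_ge0.
rewrite /predicted.
under eq_integral do rewrite dw_functional_exponential// -/C.
rewrite ge0_integralZl ?lee_fin//; last 2 first.
- apply/measurable_EFinP; apply: measurable_exponential; by have [] := pE.
- by move=> z _; rewrite lee_fin expR_ge0.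
rewrite (add_atoms_laplace pE _ _ hGam alpha0 bs0 c'0).
rewrite /mixture.
under [RHS]eq_bigr => n _.
  rewrite (add_atoms_laplace pE (fun j => n j) y hGam alpha0 bt0 c0).
  rewrite -EFinM mulrCA; over.
(* After summing over the thinned multiplicities, the base-measure factors are matched by cell and
   the remaining ones by atom. *)
rewrite sumEFin -mulr_sumr sum_ptilde -EFinM mulrA; congr EFin.
congr (_ * _)%R.
  rewrite -big_split/=; apply: eq_bigr => j _.
  rewrite -powRM ?ltW ?ratio_gt0//; congr (_ `^ _)%R.
  exact: laplace_factor_alpha.
apply: eq_bigr => i _; congr (_ ^+ _)%R.
have [j0 j0P] := partition_cell pE (y i).
by rewrite !(cell_valueE _ j0P); exact: laplace_factor_atom.
Qed.

(** Measurability is bundled with the identity because additivity and dominated convergence need it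
    at every stage. *)
Let duality_holds (h : M -> R) := [/\ measurable_functional Gam alpha beta t h,
  measurable_fun setT (dw_functional Gam alpha beta t h) &
  predicted h = mixture h].

Let duality_exponential k (E : 'I_k -> set (borel Y)) (c : 'I_k -> R) :
  measurable_partition E -> (forall j, (0 <= c j)%R) ->
  duality_holds (exponential E c).
Proof.
move=> pE c0; split; last exact: predicted_exponential.
  by move=> n; exact: measurable_gamma_functional_exponential.
rewrite (funext (dw_functional_exponential beta0 t0 pE c0 hGam alpha0)).
apply: emeasurable_funM => //; apply/measurable_EFinP.
by apply: measurable_exponential; have [] := pE.
Qed.

Let duality_sub h1 h2 h3 :
  unit_valued h1 -> unit_valued h2 -> unit_valued h3 ->
  (forall z, h1 z = h2 z + h3 z)%R ->
  duality_holds h1 -> duality_holds h2 -> duality_holds h3.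
Proof.
move=> u1 u2 u3 h123 [m1 T1 e1] [m2 T2 e2].
have m3 := measurable_functional_sub u2 u3 h123 m1 m2.
have dw01 h z : unit_valued h -> measurable_functional Gam alpha beta t h ->
    0 <= dw_functional Gam alpha beta t h z <= 1.
  exact: dw_functional01.
have D z := dw_functionalD beta0 t0 z u2 u3 h123 m2 m3.
have T3 : measurable_fun setT (dw_functional Gam alpha beta t h3).
  rewrite (_ : dw_functional _ _ _ _ _ = (fun z =>
    dw_functional Gam alpha beta t h1 z - dw_functional Gam alpha beta t h2 z)).
    exact: (emeasurable_funB T1 T2).
  apply/funext => z; rewrite D addeAC subee ?add0e//.
  have /andP[d0 d1] := dw01 h2 z u2 m2.
  by rewrite ge0_fin_numE// (le_lt_trans d1) ?ltry.
split => //.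
have predD : predicted h1 = predicted h2 + predicted h3.
  have p2 z : setT z -> 0 <= dw_functional Gam alpha beta t h2 z.
    by case/andP: (dw01 h2 z u2 m2).
  have p3 z : setT z -> 0 <= dw_functional Gam alpha beta t h3 z.
    by case/andP: (dw01 h3 z u3 m3).
  rewrite /predicted -(ge0_integralD _ measurableT p2 T2 p3 T3).
  by apply: eq_integral => z _; exact: D.
have mixD : mixture h1 = mixture h2 + mixture h3.
  rewrite /mixture -big_split; apply: eq_bigr => n _ /=.
  have ge0 (h : M -> R) P : unit_valued h -> 0 <= \int[P : probability M R]_z (h z)%:E.
    by move=> uh; apply: integral_ge0 => z _; rewrite lee_fin; case/andP: (uh.2 z).
  have ge02 z : setT z -> 0 <= (h2 z)%:E.
    by rewrite lee_fin; case/andP: (u2.2 z).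
  have ge03 z : setT z -> 0 <= (h3 z)%:E.
    by rewrite lee_fin; case/andP: (u3.2 z).
  have mE2 : measurable_fun setT (EFin \o h2) by apply/measurable_EFinP; exact: u2.1.
  have mE3 : measurable_fun setT (EFin \o h3) by apply/measurable_EFinP; exact: u3.1.
  rewrite -ge0_muleDr ?ge0//; congr (_ * _).
  rewrite -(ge0_integralD _ measurableT ge02 mE2 ge03 mE3).
  by apply: eq_integral => z _; rewrite h123 EFinD.
(* Finiteness permits cancelling the contribution of [h2] in the extended reals. *)
have pfin : predicted h2 \is a fin_num.
  have /andP[q0 q1] : 0 <= predicted h2 <= 1.
    by apply: (integral01 _ T2) => z; exact: dw01.
  by rewrite ge0_fin_numE// (le_lt_trans q1) ?ltry.
rewrite -(addeK (predicted h3) pfin) [_ + predicted h2]addeC -predD e1 mixD.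
by rewrite -e2 [predicted h2 + _]addeC addeK.
Qed.

Let duality_lim (h_ : nat -> M -> R) (h : M -> R) :
  (forall n, unit_valued (h_ n)) -> unit_valued h ->
  (forall z, h_ n z @[n --> \oo] --> h z) ->
  (forall n, duality_holds (h_ n)) -> duality_holds h.
Proof.
move=> u_ u hh H_.
have mh_ n : measurable_functional Gam alpha beta t (h_ n) by case: (H_ n).
have cdw z := dw_functional_cvg beta0 t0 u_ hh mh_ z.
split.
- exact: (measurable_functional_cvg u_ hh mh_).
- apply: (emeasurable_fun_cvg (fun n => dw_functional Gam alpha beta t (h_ n))).
    by move=> n; case: (H_ n).
  by move=> z _; exact: cdw.
- have cp : predicted (h_ n) @[n --> \oo] --> predicted h.
    apply: dominated_cvg01; last exact: cdw.
      by move=> n; case: (H_ n).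
    by move=> n z; apply: (dw_functional01 beta0 t0).
  (* The same sequence, rewritten through [mixture], converges term by term in a finite sum. *)
  apply: (cvg_unique _ cp) => //.
  have -> : (fun n => predicted (h_ n)) = (fun n => mixture (h_ n)).
    by apply/funext => n; case: (H_ n).
  rewrite /mixture; apply: cvg_nnesum => n _.
    apply: nearW => i; rewrite mule_ge0 ?lee_fin ?ptilde_ge0//.
    by apply: integral_ge0 => z _; rewrite lee_fin; case/andP: ((u_ i).2 z).
  by apply: cvgeZl => //; exact: integral_cvg.
Qed.

Lemma prediction_mixture (B : set M) : measurable B ->
  prediction Gam alpha beta t (Gam (add_atoms_fm alpha m y) (beta + s)%R) B =
  \sum_(n : lower_set m) (ptilde beta s t m (fun j => n j))%:E *
    Gam (add_atoms_fm alpha (fun j => n j) y) (beta + Scoef beta s t)%R B.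
Proof.
move=> mB.
have [_ _] := exponential_class_measurable duality_exponential duality_sub
  duality_lim mB.
rewrite /predicted /mixture /prediction.
under eq_integral do rewrite dw_functional_indic//.
move=> ->; apply: eq_bigr => n _.
by rewrite integral_indic// setIT.
Qed.

End duality.

Theorem theorem3p5 (R : realType) (Y : ptopologicalType)
    (hlc : locally_compact [set: Y]) (hpol : polish R Y)
    (theta beta : R) (htheta : 0 < theta) (hbeta : 0 < beta)
    (P0 : probability (borel Y) R) (hP0 : no_atoms P0)
    (Gam : finite_measures (borel Y) R -> R ->
           probability (finite_measures (borel Y) R) R)
    (hGam : gamma_random_measures Gam)
    (t s : R) (ht : 0 < t) (hs : 0 < s)
    (K : nat) (y : 'I_K -> borel Y) (hy : injective y) (m : 'I_K -> nat)
    (B : set (finite_measures (borel Y) R)) (hB : measurable B) :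
  let alpha : finite_measures (borel Y) R :=
    mscale (NngNum (ltW htheta)) P0 in
  prediction Gam alpha beta t (Gam (add_atoms_fm alpha m y) (beta + s)) B =
  (\sum_(n : lower_set m)
     (ptilde beta s t m (fun j => n j))%:E *
     Gam (add_atoms_fm alpha (fun j => n j) y) (beta + Scoef beta s t)%R B)%E.
Proof.
move=> alpha; apply: prediction_mixture => //.
(* The total mass of [alpha] is [theta], hence nonzero. *)
by rewrite /alpha /= /mscale /= probability_setT mule1 eqe gt_eqF.
Qed.
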